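(* Let $t$ be a well-typed term, i.e. a term such that $\Gamma\vdash t:T$ is derivable for some context $\Gamma$ and some type $T$. Then $t$ is perfectly normalising for $\lambda_{\mathcal C}^-$: there is no infinite $\to$-reduction sequence starting from $t$, and every term $t'$ with $t\to^* t'$ is defined.
   Context: **Terms.** Fix two disjoint sets of variables $x,y,\dots$ and constructors $\mathtt c,\mathtt d,\dots$. Terms and case bindings are defined by mutual induction: terms $s,t,u ::= x \mid \lambda x.t \mid tu \mid \mathtt c \mid \{\!|\theta|\!\}\cdot t \mid \maltese$; case bindings $\theta,\phi ::= \{\mathtt c_1\mapsto u_1;\dots;\mathtt c_n\mapsto u_n\}$ ($n\ge 0$, the $\mathtt c_i$ pairwise distinct), with $\mathrm{dom}(\theta)=\{\mathtt c_1,\dots,\mathtt c_n\}$. Terms are taken up to $\alpha$-conversion; $FV(\{\!|\theta|\!\}\cdot t)=FV(\theta)\cup FV(t)$, $FV(\theta)=\bigcup_i FV(u_i)$, constructors are not variables. Substitution is capture-avoiding. **Reduction** ($\lambda_{\mathcal C}^-$). $\to$ is the contextual closure (including inside case bindings) of: $(\lambda x.t)u\to t[x:=u]$; $\maltese\,u\to\maltese$; $\lambda x.tx\to t$ if $x\notin FV(t)$; $\lambda x.\maltese\to\maltese$; $\{\!|\theta|\!\}\cdot\mathtt c\to u$ if $(\mathtt c\mapsto u)\in\theta$; $\{\!|\theta|\!\}\cdot\maltese\to\maltese$; $\{\!|\theta|\!\}\cdot(tu)\to(\{\!|\theta|\!\}\cdot t)u$; $\{\!|\theta|\!\}\cdot\lambda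 x.t\to\lambda x.\{\!|\theta|\!\}\cdot t$ if $x\notin FV(\theta)$. $\to^*$ is its reflexive transitive closure. A term is *defined* if it has no subterm $\{\!|\theta|\!\}\cdot\mathtt c$ with $\mathtt c\notin\mathrm{dom}(\theta)$. **Types.** There are ordinary type variables $X$ and data type variables $\alpha$; $\nu$ denotes a variable of either kind. Each constructor $\mathtt c$ has an associated type constant $\mathbf c$. Types: $T,U ::= X\mid\alpha\mid\mathbf c\mid DT\mid T\to U\mid T\cup U\mid T\cap U\mid\forall\alpha.T\mid\forall X.T\mid\exists\alpha.T\mid\exists X.T$. Data types (a syntactic subclass of types): $D,E ::= \alpha\mid\mathbf c\mid DT\mid D\cup E\mid D\cap E\mid\forall\alpha.D\mid\forall X.D\mid\exists\alpha.D\mid\exists X.D$. $TV(T)$ is the set of free type variables. For a finite, possibly empty, sequence $\vec T=T_1;\dots;T_k$: $\mathbf c\vec T=(\dots(\mathbf cT_1)\dots)T_k$ and $\vec T\to U=T_1\to(\dots\to(T_k\to U))$. Type application binds tightest and is left associative. **Subtyping** $T\preccurlyeq U$ is generated by the following rules ($D,D',D_i$ data types; $i$ ranges over finite nonempty index sets). - $T\preccurlyeq T$; transitivity. - If $T'\preccurlyeq T$, $U\preccurlyeq U'$ then $T\to U\preccurlyeq T'\to U'$. If $D\preccurlyeq D'$, $T\preccurlyeq T'$ then $DT\preccurlyeq D'T'$. - $U_j\preccurlyeq U_1\cup U_2$ ($j=1,2$); if $T_1\preccurlyeq U$, $T_2\preccurlyeq U$ then $T_1\cup T_2\preccurlyeq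 U$. $U_1\cap U_2\preccurlyeq U_j$ ($j=1,2$); if $T\preccurlyeq U_1$, $T\preccurlyeq U_2$ then $T\preccurlyeq U_1\cap U_2$. - If $T\preccurlyeq U$ and $\nu\notin TV(T)$ then $T\preccurlyeq\forall\nu.U$; $\forall X.T\preccurlyeq T\{X\leftarrow U\}$; $\forall\alpha.T\preccurlyeq T\{\alpha\leftarrow D\}$. $T\{X\leftarrow U\}\preccurlyeq\exists X.T$; $T\{\alpha\leftarrow D\}\preccurlyeq\exists\alpha.T$; if $U\preccurlyeq T$ and $\nu\notin TV(T)$ then $\exists\nu.U\preccurlyeq T$. - $D\preccurlyeq T\to DT$; $\mathbf c_1\vec T\cap\mathbf c_2\vec U\preccurlyeq\forall\alpha.\alpha$ if $\mathtt c_1\ne\mathtt c_2$. - $\bigcap_iD_iT_i\preccurlyeq(\bigcap_iD_i)(\bigcap_iT_i)$; $\forall\nu.(DT)\preccurlyeq(\forall\nu.D)(\forall\nu.T)$. - $\bigcap_i(T_i\to U_i)\preccurlyeq(\bigcap_iT_i)\to(\bigcap_iU_i)$; $\forall\nu.(T\to U)\preccurlyeq(\forall\nu.T)\to(\forall\nu.U)$; $\bigcap_i(T_i\to U_i)\preccurlyeq(\bigcup_iT_i)\to(\bigcup_iU_i)$; $\forall\nu.(T\to U)\preccurlyeq(\exists\nu.T)\to(\exists\nu.U)$. - $D(\bigcup_iT_i)\preccurlyeq\bigcup_iDT_i$; $(\bigcup_iD_i)T\preccurlyeq\bigcup_i(D_iT)$; $D(\exists\nu.T)\preccurlyeq\exists\nu.DT$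 if $\nu\notin TV(D)$; $(\exists\nu.D)T\preccurlyeq\exists\nu.DT$ if $\nu\notin TV(T)$. - $\forall\nu.(T\cup U)\preccurlyeq(\forall\nu.T)\cup U$ and $(\exists\nu.T)\cap U\preccurlyeq\exists\nu.(T\cap U)$, both if $\nu\notin TV(U)$. **Typing.** Contexts $\Gamma$ are finite sets of declarations $x:T$ with distinct variables. Judgements $\Gamma\vdash t:T$ and $\Gamma\vdash\theta:T$ are generated by the following rules, where $\theta=\{\mathtt c_i\mapsto u_i\mid1\le i\le n\}$, $n\ge0$. - (Cb) If $\Gamma\vdash u_i:\vec{U_i}\to T_i$ for all $1\le i\le n$, then $\Gamma\vdash\theta:\mathbf c_{i_0}\vec{U_{i_0}}\to T_{i_0}$ for any $1\le i_0\le n$. - (Cb$_\bot$) If $\Gamma\vdash u_i:T_i$ for all $i$, then $\Gamma\vdash\theta:(\forall\alpha.\alpha)\to(\forall X.X)$. - $\Gamma\vdash x:T$ if $(x:T)\in\Gamma$; $\Gamma\vdash\maltese:T$ for every $T$; $\Gamma\vdash\mathtt c:\mathbf c$. - If $\Gamma,x:T\vdash t:U$ then $\Gamma\vdash\lambda x.t:T\to U$. If $\Gamma\vdash t:T\to U$ and $\Gamma\vdash u:T$ then $\Gamma\vdash tu:U$. - (case) If $\Gamma\vdash t:\vec U\to T$ and $\Gamma\vdash\theta:T\to T'$ then $\Gamma\vdash\{\!|\theta|\!\}\cdot t:\vec U\to T'$. - Shared rules, $M$ a term or a case binding: if $\Gamma\vdash M:T$ and $\nu\notin TV(\Gamma)$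 then $\Gamma\vdash M:\forall\nu.T$; if $\Gamma\vdash M:T$ and $\Gamma\vdash M:U$ then $\Gamma\vdash M:T\cap U$; if $\Gamma,x:T\vdash M:U$ and $\nu\notin TV(U)$ then $\Gamma,x:\exists\nu.T\vdash M:U$ (where, as usual, $\nu$ also does not occur free in $\Gamma$); if $\Gamma,x:T_1\vdash M:U$ and $\Gamma,x:T_2\vdash M:U$ then $\Gamma,x:T_1\cup T_2\vdash M:U$; if $\Gamma\vdash M:T$ and $T\preccurlyeq U$ then $\Gamma\vdash M:U$. *)

(* Defs.v *)
From Stdlib Require Import List Relations.
Import ListNotations.

Set Implicit Arguments.

(** [C] is the set of constructors.  Term variables are de Bruijn indices, so
    alpha-equivalent terms are equal. *)
Inductive term (C : Type) : Type :=
| Var (x : nat)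
| Lam (t : term C)
| App (t u : term C)
| Con (c : C)
| Case (theta : list (C * term C)) (t : term C)
| Dai.

Arguments Var {C} x.
Arguments Con {C} c.
Arguments Dai {C}.

Definition binding (C : Type) : Type := list (C * term C).

Definition dom {C : Type} (theta : binding C) : list C := map fst theta.

Definition up_ren (r : nat -> nat) (x : nat) : nat :=
  match x with 0 => 0 | S y => S (r y) end.

Fixpoint ren {C : Type} (r : nat -> nat) (t : term C) : term C :=
  match t with
  | Var x => Var (r x)
  | Lam t => Lam (ren (up_ren r) t)
  | App t u => App (ren r t) (ren r u)
  | Con c => Con c
  | Case theta t => Case (map (fun cu => (fst cu, ren r (snd cu))) theta) (ren r t)
  | Dai => Dai
  end.

Definition shift {C : Type} : term C -> term C := ren S.

Definition shift_binding {C : Type} : binding C -> binding C :=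
  map (fun cu => (fst cu, shift (snd cu))).

Definition up {C : Type} (s : nat -> term C) (x : nat) : term C :=
  match x with 0 => Var 0 | S y => shift (s y) end.

Fixpoint subst {C : Type} (s : nat -> term C) (t : term C) : term C :=
  match t with
  | Var x => s x
  | Lam t => Lam (subst (up s) t)
  | App t u => App (subst s t) (subst s u)
  | Con c => Con c
  | Case theta t => Case (map (fun cu => (fst cu, subst s (snd cu))) theta) (subst s t)
  | Dai => Dai
  end.

(** [t[0 := u]], the other indices being decremented. *)
Definition subst0 {C : Type} (u t : term C) : term C :=
  subst (fun x => match x with 0 => u | S y => Var y end) t.

Inductive subterm {C : Type} (s : term C) : term C -> Prop :=
| subterm_refl : subterm s s
| subterm_Lam t : subterm s t -> subterm s (Lam t)
| subterm_App_l t u : subterm s t -> subterm s (App t u)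
| subterm_App_r t u : subterm s u -> subterm s (App t u)
| subterm_Case theta t : subterm s t -> subterm s (Case theta t)
| subterm_binding theta c u t :
    In (c, u) theta -> subterm s u -> subterm s (Case theta t).

(** The grammar requires the constructors of a case binding to be pairwise
    distinct; raw terms do not enforce it. *)
Definition wf_term {C : Type} (t : term C) : Prop :=
  forall theta u, subterm (Case theta u) t -> NoDup (dom theta).

Definition defined {C : Type} (t : term C) : Prop :=
  ~ exists theta c, subterm (Case theta (Con c)) t /\ ~ In c (dom theta).

(** In de Bruijn notation [x] is not free in a term exactly when that term is a
    shift; this is how the side conditions of [step_eta] and [step_case_lam]
    appear. *)
Inductive step {C : Type} : term C -> term C -> Prop :=
| step_beta t u : step (App (Lam t) u) (subst0 u t)
| step_dai_app u : step (App Dai u) Dai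
| step_eta t : step (Lam (App (shift t) (Var 0))) t
| step_lam_dai : step (Lam Dai) Dai
| step_case_con theta c u : In (c, u) theta -> step (Case theta (Con c)) u
| step_case_dai theta : step (Case theta Dai) Dai
| step_case_app theta t u :
    step (Case theta (App t u)) (App (Case theta t) u)
| step_case_lam theta t :
    step (Case theta (Lam t)) (Lam (Case (shift_binding theta) t))
| step_Lam t t' : step t t' -> step (Lam t) (Lam t')
| step_App_l t t' u : step t t' -> step (App t u) (App t' u)
| step_App_r t u u' : step u u' -> step (App t u) (App t u')
| step_Case theta t t' : step t t' -> step (Case theta t) (Case theta t')
| step_binding theta1 c u u' theta2 t :
    step u u' ->
    step (Case (theta1 ++ (c, u) :: theta2) t)
         (Case (theta1 ++ (c, u') :: theta2) t).

Definition steps {C : Type} : term C -> term C -> Prop :=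
  clos_refl_trans (term C) step.

Definition perfectly_normalising {C : Type} (t : term C) : Prop :=
  (~ exists f : nat -> term C, f 0 = t /\ forall n, step (f n) (f (S n))) /\
  (forall t', steps t t' -> defined t').

(** [Ord]: ordinary type variables; [Dat]: data type variables. *)
Inductive kind : Type := Ord | Dat.

Definition kind_eqb (k k' : kind) : bool :=
  match k, k' with Ord, Ord | Dat, Dat => true | _, _ => false end.

(** Type variables are de Bruijn indices, counted separately for each kind:
    [TAll k T] and [TEx k T] bind index 0 of kind [k] in [T]. *)
Inductive type (C : Type) : Type :=
| TVar (k : kind) (n : nat)
| TCon (c : C)
| TApp (D T : type C)
| TArr (T U : type C)
| TCup (T U : type C)
| TCap (T U : type C)
| TAll (k : kind) (T : type C)
| TEx (k : kind) (T : type C).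

Arguments TVar {C} k n.
Arguments TCon {C} c.

(** [wf_type Dat T]: [T] is a data type; [wf_type Ord T]: [T] is a type.  Thus
    [wf_type k U] also says that [U] may be substituted for a variable of kind
    [k]. *)
Fixpoint wf_type {C : Type} (k : kind) (T : type C) : Prop :=
  match T with
  | TVar k' _ => k = Ord \/ k' = Dat
  | TCon _ => True
  | TApp D T => wf_type Dat D /\ wf_type Ord T
  | TArr T U => k = Ord /\ wf_type Ord T /\ wf_type Ord U
  | TCup T U | TCap T U => wf_type k T /\ wf_type k U
  | TAll _ T | TEx _ T => wf_type k T
  end.

Definition up_tren (k : kind) (r : kind -> nat -> nat) (k' : kind) (n : nat) : nat :=
  if kind_eqb k k' then match n with 0 => 0 | S m => S (r k' m) end else r k' n.

Fixpoint tren {C : Type} (r : kind -> nat -> nat) (T : type C) : type C :=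
  match T with
  | TVar k n => TVar k (r k n)
  | TCon c => TCon c
  | TApp D T => TApp (tren r D) (tren r T)
  | TArr T U => TArr (tren r T) (tren r U)
  | TCup T U => TCup (tren r T) (tren r U)
  | TCap T U => TCap (tren r T) (tren r U)
  | TAll k T => TAll k (tren (up_tren k r) T)
  | TEx k T => TEx k (tren (up_tren k r) T)
  end.

Definition tshift {C : Type} (k : kind) : type C -> type C :=
  tren (fun k' n => if kind_eqb k k' then S n else n).

Definition up_t {C : Type} (k : kind) (s : kind -> nat -> type C)
    (k' : kind) (n : nat) : type C :=
  if kind_eqb k k'
  then match n with 0 => TVar k 0 | S m => tshift k (s k' m) end
  else tshift k (s k' n).

Fixpoint tsubst {C : Type} (s : kind -> nat -> type C) (T : type C) : type C :=
  match T with
  | TVar k n => s k n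
  | TCon c => TCon c
  | TApp D T => TApp (tsubst s D) (tsubst s T)
  | TArr T U => TArr (tsubst s T) (tsubst s U)
  | TCup T U => TCup (tsubst s T) (tsubst s U)
  | TCap T U => TCap (tsubst s T) (tsubst s U)
  | TAll k T => TAll k (tsubst (up_t k s) T)
  | TEx k T => TEx k (tsubst (up_t k s) T)
  end.

(** [T{nu <- U}] where [nu] is index 0 of kind [k]. *)
Definition tsubst0 {C : Type} (k : kind) (U T : type C) : type C :=
  tsubst (fun k' n =>
    if kind_eqb k k' then match n with 0 => U | S m => TVar k' m end
    else TVar k' n) T.

Definition tapps {C : Type} (T : type C) (Us : list (type C)) : type C :=
  fold_left (@TApp C) Us T.

Definition tarrs {C : Type} (Us : list (type C)) (T : type C) : type C :=
  fold_right (@TArr C) T Us.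

Fixpoint big {C : Type} (op : type C -> type C -> type C) (n : nat)
    (F : nat -> type C) : type C :=
  match n with
  | 0 => F 0
  | S m => op (big op m F) (F (S m))
  end.

(** The nonempty finite index set of the n-ary operators is [{0, ..., n}]. *)
Definition bigcap {C : Type} : nat -> (nat -> type C) -> type C := big (@TCap C).
Definition bigcup {C : Type} : nat -> (nat -> type C) -> type C := big (@TCup C).

(** A condition [nu \notin TV(T)] on a type occurring both inside and outside
    the scope of the binder of [nu] becomes [tshift] on the inner occurrence.
    The [wf_type] premises make the relation one between well-formed types. *)
Inductive sub {C : Type} : type C -> type C -> Prop :=
| sub_refl T : wf_type Ord T -> sub T T
| sub_trans T U V : sub T U -> sub U V -> sub T V
| sub_arr T T' U U' : sub T' T -> sub U U' -> sub (TArr T U) (TArr T' U')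
| sub_app D D' T T' :
    wf_type Dat D -> wf_type Dat D' ->
    sub D D' -> sub T T' -> sub (TApp D T) (TApp D' T')
| sub_cup_r1 U1 U2 : wf_type Ord U1 -> wf_type Ord U2 -> sub U1 (TCup U1 U2)
| sub_cup_r2 U1 U2 : wf_type Ord U1 -> wf_type Ord U2 -> sub U2 (TCup U1 U2)
| sub_cup_l T1 T2 U : sub T1 U -> sub T2 U -> sub (TCup T1 T2) U
| sub_cap_l1 U1 U2 : wf_type Ord U1 -> wf_type Ord U2 -> sub (TCap U1 U2) U1
| sub_cap_l2 U1 U2 : wf_type Ord U1 -> wf_type Ord U2 -> sub (TCap U1 U2) U2
| sub_cap_r T U1 U2 : sub T U1 -> sub T U2 -> sub T (TCap U1 U2)
| sub_all_r k T U : sub (tshift k T) U -> sub T (TAll k U)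
| sub_all_l k T U :
    wf_type Ord T -> wf_type k U -> sub (TAll k T) (tsubst0 k U T)
| sub_ex_r k T U :
    wf_type Ord T -> wf_type k U -> sub (tsubst0 k U T) (TEx k T)
| sub_ex_l k T U : sub U (tshift k T) -> sub (TEx k U) T
| sub_data D T : wf_type Dat D -> wf_type Ord T -> sub D (TArr T (TApp D T))
| sub_con_neq c1 c2 Ts Us :
    c1 <> c2 -> Forall (wf_type Ord) Ts -> Forall (wf_type Ord) Us ->
    sub (TCap (tapps (TCon c1) Ts) (tapps (TCon c2) Us)) (TAll Dat (TVar Dat 0))
| sub_cap_app n D T :
    (forall i, i <= n -> wf_type Dat (D i)) ->
    (forall i, i <= n -> wf_type Ord (T i)) ->
    sub (bigcap n (fun i => TApp (D i) (T i))) (TApp (bigcap n D) (bigcap n T))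
| sub_all_app k D T :
    wf_type Dat D -> wf_type Ord T ->
    sub (TAll k (TApp D T)) (TApp (TAll k D) (TAll k T))
| sub_cap_arr_cap n T U :
    (forall i, i <= n -> wf_type Ord (T i)) ->
    (forall i, i <= n -> wf_type Ord (U i)) ->
    sub (bigcap n (fun i => TArr (T i) (U i))) (TArr (bigcap n T) (bigcap n U))
| sub_all_arr_all k T U :
    wf_type Ord T -> wf_type Ord U ->
    sub (TAll k (TArr T U)) (TArr (TAll k T) (TAll k U))
| sub_cap_arr_cup n T U :
    (forall i, i <= n -> wf_type Ord (T i)) ->
    (forall i, i <= n -> wf_type Ord (U i)) ->
    sub (bigcap n (fun i => TArr (T i) (U i))) (TArr (bigcup n T) (bigcup n U))
| sub_all_arr_ex k T U :
    wf_type Ord T -> wf_type Ord U ->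
    sub (TAll k (TArr T U)) (TArr (TEx k T) (TEx k U))
| sub_app_cup_r n D T :
    wf_type Dat D -> (forall i, i <= n -> wf_type Ord (T i)) ->
    sub (TApp D (bigcup n T)) (bigcup n (fun i => TApp D (T i)))
| sub_app_cup_l n D T :
    (forall i, i <= n -> wf_type Dat (D i)) -> wf_type Ord T ->
    sub (TApp (bigcup n D) T) (bigcup n (fun i => TApp (D i) T))
| sub_app_ex_r k D T :
    wf_type Dat D -> wf_type Ord T ->
    sub (TApp D (TEx k T)) (TEx k (TApp (tshift k D) T))
| sub_app_ex_l k D T :
    wf_type Dat D -> wf_type Ord T ->
    sub (TApp (TEx k D) T) (TEx k (TApp D (tshift k T)))
| sub_all_cup k T U :
    wf_type Ord T -> wf_type Ord U ->
    sub (TAll k (TCup T (tshift k U))) (TCup (TAll k T) U)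
| sub_ex_cap k T U :
    wf_type Ord T -> wf_type Ord U ->
    sub (TCap (TEx k T) U) (TEx k (TCap T (tshift k U))).

(** The subjects of typing judgements. *)
Inductive expr (C : Type) : Type :=
| ETerm (t : term C)
| EBinding (theta : binding C).

(** The [n]-th type of a context is that of the variable [Var n]. *)
Definition ctx (C : Type) : Type := list (type C).

Definition wf_ctx {C : Type} (G : ctx C) : Prop := Forall (wf_type Ord) G.

(** In [ty_cb] and [ty_cb_bot] the families of types are indexed by the
    (pairwise distinct) constructors of the binding. *)
Inductive typing {C : Type} : ctx C -> expr C -> type C -> Prop :=
| ty_cb G theta (Us : C -> list (type C)) (T : C -> type C) c0 :
    (forall c u, In (c, u) theta -> typing G (ETerm u) (tarrs (Us c) (T c))) ->
    In c0 (dom theta) ->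
    typing G (EBinding theta) (TArr (tapps (TCon c0) (Us c0)) (T c0))
| ty_cb_bot G theta (T : C -> type C) :
    wf_ctx G ->
    (forall c u, In (c, u) theta -> typing G (ETerm u) (T c)) ->
    typing G (EBinding theta)
      (TArr (TAll Dat (TVar Dat 0)) (TAll Ord (TVar Ord 0)))
| ty_var G x T :
    wf_ctx G -> nth_error G x = Some T -> typing G (ETerm (Var x)) T
| ty_dai G T : wf_ctx G -> wf_type Ord T -> typing G (ETerm Dai) T
| ty_con G c : wf_ctx G -> typing G (ETerm (Con c)) (TCon c)
| ty_lam G t T U :
    typing (T :: G) (ETerm t) U -> typing G (ETerm (Lam t)) (TArr T U)
| ty_app G t u T U :
    typing G (ETerm t) (TArr T U) -> typing G (ETerm u) T ->
    typing G (ETerm (App t u)) U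
| ty_case G theta t Us T T' :
    typing G (ETerm t) (tarrs Us T) -> typing G (EBinding theta) (TArr T T') ->
    typing G (ETerm (Case theta t)) (tarrs Us T')
| ty_all G M k T : typing (map (tshift k) G) M T -> typing G M (TAll k T)
| ty_cap G M T U : typing G M T -> typing G M U -> typing G M (TCap T U)
| ty_ex G1 G2 M k T U :
    typing (map (tshift k) G1 ++ T :: map (tshift k) G2) M (tshift k U) ->
    typing (G1 ++ TEx k T :: G2) M U
| ty_cup G1 G2 M T1 T2 U :
    typing (G1 ++ T1 :: G2) M U -> typing (G1 ++ T2 :: G2) M U ->
    typing (G1 ++ TCup T1 T2 :: G2) M U
| ty_sub G M T U : typing G M T -> sub T U -> typing G M U.

Definition well_typed {C : Type} (t : term C) : Prop :=
  exists (G : ctx C) (T : type C), typing G (ETerm t) T.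

(* Main.v *)
(** Reducibility with saturated sets: a type denotes a set of strongly normalising
    terms containing the daimon and closed under weak head reduction and weak head
    expansion.  Such sets are stable under set-theoretic union and intersection,
    which therefore interpret the connectives and quantifiers and validate the
    distribution rules of subtyping.  Weak head reduction is deterministic, so a
    term of a data type has a unique value, the daimon or [c u1 ... uk]; reading
    [D T] off this value makes application commute with intersections and separates
    distinct constructors.  Closure under expansion rests on a local commutation of
    weak head reduction with full reduction.  Match failure is turned into a loop, so
    that strong normalisation also yields definedness, and free variables are handled
    by substituting the daimon for them. *)

From Stdlib Require Import List Relations Lia.
From Stdlib Require Import Classical FunctionalExtensionality.
Require Import Defs.
Import ListNotations.

Set Implicit Arguments.

(** * Induction on terms and maps over case bindings *)

Lemma term_nested_ind (C : Type) (P : term C -> Prop)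
    (HVar : forall x, P (Var x))
    (HLam : forall t, P t -> P (Lam t))
    (HApp : forall t u, P t -> P u -> P (App t u))
    (HCon : forall c, P (Con c))
    (HCase : forall theta t,
      (forall c u, In (c, u) theta -> P u) -> P t -> P (Case theta t))
    (HDai : P Dai) :
  forall t, P t.
Proof.
  fix IH 1. intros [x|t|t u|c|theta t|].
  - apply HVar.
  - apply HLam, IH.
  - apply HApp; apply IH.
  - apply HCon.
  - apply HCase; [|apply IH].
    (* The inner induction on the list applies the outer fixpoint to each branch, which keeps the
       recursion structural. *)
    induction theta as [|[d v] theta IHtheta]; simpl; intros c u Hin.
    + contradiction.
    + destruct Hin as [[= _ <-]|Hin]; [apply IH|exact (IHtheta c u Hin)].
  - apply HDai.
Qed.

Definition bmap {C : Type} (f : term C -> term C) (theta : binding C) : binding C :=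
  map (fun cu => (fst cu, f (snd cu))) theta.

Lemma bmap_ext_in (C : Type) (f g : term C -> term C) (theta : binding C) :
  (forall c u, In (c, u) theta -> f u = g u) -> bmap f theta = bmap g theta.
Proof.
  intros H. apply map_ext_in. intros [c u] Hin. simpl. f_equal. exact (H c u Hin).
Qed.

Lemma bmap_bmap (C : Type) (f g : term C -> term C) (theta : binding C) :
  bmap f (bmap g theta) = bmap (fun t => f (g t)) theta.
Proof. unfold bmap. rewrite map_map. reflexivity. Qed.

Lemma dom_bmap (C : Type) (f : term C -> term C) (theta : binding C) :
  dom (bmap f theta) = dom theta.
Proof. unfold dom, bmap. rewrite map_map. reflexivity. Qed.

Lemma in_bmap (C : Type) (f : term C -> term C) (theta : binding C) c u :
  In (c, u) (bmap f theta) -> exists v, In (c, v) theta /\ u = f v.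
Proof.
  unfold bmap. rewrite in_map_iff. intros [[d v] [[= <- <-] Hin]]. eauto.
Qed.

Lemma bmap_id (C : Type) (f : term C -> term C) (theta : binding C) :
  (forall c u, In (c, u) theta -> f u = u) -> bmap f theta = theta.
Proof.
  intros H. transitivity (map (fun cu => cu) theta); [|apply map_id].
  apply map_ext_in. intros [c u] Hin. simpl. f_equal. exact (H c u Hin).
Qed.

(** * Substitution *)

Lemma up_var (C : Type) (r : nat -> nat) :
  up (fun x => @Var C (r x)) = (fun x => Var (up_ren r x)).
Proof. extensionality x. destruct x; reflexivity. Qed.

Lemma ren_as_subst (C : Type) (t : term C) :
  forall r, ren r t = subst (fun x => Var (r x)) t.
Proof.
  induction t using term_nested_ind; intros r; simpl; f_equal; auto.
  - rewrite up_var. auto.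
  - apply bmap_ext_in. eauto.
Qed.

Lemma subst_var (C : Type) (t : term C) : subst Var t = t.
Proof.
  induction t using term_nested_ind; simpl; f_equal; auto.
  - replace (up Var) with (@Var C); auto.
    extensionality x. destruct x; reflexivity.
  - apply bmap_id. assumption.
Qed.

Lemma subst_ren (C : Type) (t : term C) :
  forall s r, subst s (ren r t) = subst (fun x => s (r x)) t.
Proof.
  induction t using term_nested_ind; intros s r; simpl; f_equal; auto.
  - rewrite IHt. f_equal. extensionality x. destruct x; reflexivity.
  - fold (bmap (ren r) theta). fold (bmap (subst s) (bmap (ren r) theta)).
    rewrite bmap_bmap. apply bmap_ext_in. eauto.
Qed.

Lemma ren_ren (C : Type) (t : term C) (r1 r2 : nat -> nat) :
  ren r1 (ren r2 t) = ren (fun x => r1 (r2 x)) t.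
Proof.
  rewrite (ren_as_subst (ren r2 t)), subst_ren, ren_as_subst. reflexivity.
Qed.

Lemma ren_subst (C : Type) (t : term C) :
  forall r s, ren r (subst s t) = subst (fun x => ren r (s x)) t.
Proof.
  induction t using term_nested_ind; intros r s; simpl; f_equal; auto.
  - rewrite IHt. f_equal. extensionality x. destruct x; [reflexivity|].
    simpl. unfold shift. rewrite !ren_ren. reflexivity.
  - fold (bmap (subst s) theta). fold (bmap (ren r) (bmap (subst s) theta)).
    rewrite bmap_bmap. apply bmap_ext_in. eauto.
Qed.

Lemma subst_up_shift (C : Type) (s : nat -> term C) (t : term C) :
  subst (up s) (shift t) = shift (subst s t).
Proof. unfold shift. rewrite subst_ren, ren_subst. reflexivity. Qed.

Lemma subst_subst (C : Type) (t : term C) :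
  forall s1 s2, subst s1 (subst s2 t) = subst (fun x => subst s1 (s2 x)) t.
Proof.
  induction t using term_nested_ind; intros s1 s2; simpl; f_equal; auto.
  - rewrite IHt. f_equal. extensionality x. destruct x; [reflexivity|].
    apply subst_up_shift.
  - fold (bmap (subst s2) theta). fold (bmap (subst s1) (bmap (subst s2) theta)).
    rewrite bmap_bmap. apply bmap_ext_in. eauto.
Qed.

Definition scons {C : Type} (u : term C) (s : nat -> term C) (x : nat) : term C :=
  match x with 0 => u | S y => s y end.

Lemma subst0_shift (C : Type) (u t : term C) : subst0 u (shift t) = t.
Proof. unfold subst0, shift. rewrite subst_ren. apply subst_var. Qed.

(** Identifies the contractum of a closed-up beta-redex with the body under an extended environment,
    as soundness of abstraction needs. *)
Lemma subst0_subst_up (C : Type) (u t : term C) (s : nat -> term C) :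
  subst0 u (subst (up s) t) = subst (scons u s) t.
Proof.
  unfold subst0. rewrite subst_subst. f_equal. extensionality x.
  destruct x; [reflexivity|]. apply subst0_shift.
Qed.

Lemma subst_subst0 (C : Type) (u t : term C) (s : nat -> term C) :
  subst s (subst0 u t) = subst0 (subst s u) (subst (up s) t).
Proof.
  rewrite subst0_subst_up. unfold subst0. rewrite subst_subst. f_equal.
  extensionality x. destruct x; reflexivity.
Qed.

Lemma bmap_subst_shift (C : Type) (s : nat -> term C) (theta : binding C) :
  bmap (subst (up s)) (shift_binding theta) = shift_binding (bmap (subst s) theta).
Proof.
  change (@shift_binding C) with (bmap (@shift C)). rewrite !bmap_bmap.
  apply bmap_ext_in. intros c u _. apply subst_up_shift.
Qed.

Lemma subst0_shift_binding (C : Type) (u : term C) (theta : binding C) :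
  bmap (subst0 u) (shift_binding theta) = theta.
Proof.
  change (@shift_binding C) with (bmap (@shift C)). rewrite bmap_bmap.
  apply bmap_id. intros c v _. apply subst0_shift.
Qed.

Lemma subst0_case_shift (C : Type) (u t : term C) (theta : binding C) :
  subst0 u (Case (shift_binding theta) t) = Case theta (subst0 u t).
Proof.
  unfold subst0 at 1. simpl. f_equal. apply subst0_shift_binding.
Qed.

(** * Reduction *)

(** First-match lookup: without [NoDup] on the domain, looking up any matching
    branch would make head reduction nondeterministic. *)
Inductive look {C : Type} (c : C) (u : term C) : binding C -> Prop :=
| look_here theta : look c u ((c, u) :: theta)
| look_there d v theta : d <> c -> look c u theta -> look c u ((d, v) :: theta).

Inductive root {C : Type} : term C -> term C -> Prop :=
| root_beta t u : root (App (Lam t) u) (subst0 u t)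
| root_dai_app u : root (App Dai u) Dai
| root_case_con theta c u : look c u theta -> root (Case theta (Con c)) u
| root_case_dai theta : root (Case theta Dai) Dai
| root_case_app theta t u :
    root (Case theta (App t u)) (App (Case theta t) u)
| root_case_lam theta t :
    root (Case theta (Lam t)) (Lam (Case (shift_binding theta) t)).

(** [red_stuck] makes match failure diverge, so that strong normalisation for
    [red] is perfect normalisation. *)
Inductive red {C : Type} : term C -> term C -> Prop :=
| red_root t t' : root t t' -> red t t'
| red_eta t : red (Lam (App (shift t) (Var 0))) t
| red_lam_dai : red (Lam Dai) Dai
| red_stuck theta c : ~ In c (dom theta) ->
    red (Case theta (Con c)) (Case theta (Con c))
| red_Lam t t' : red t t' -> red (Lam t) (Lam t')
| red_App_l t t' u : red t t' -> red (App t u) (App t' u)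
| red_App_r t u u' : red u u' -> red (App t u) (App t u')
| red_Case theta t t' : red t t' -> red (Case theta t) (Case theta t')
| red_binding theta1 c u u' theta2 t :
    red u u' ->
    red (Case (theta1 ++ (c, u) :: theta2) t)
        (Case (theta1 ++ (c, u') :: theta2) t).

(** Weak head reduction. Under [Case theta] it only enters another [Case], since
    the commutation with [App] takes precedence. *)
Inductive wh {C : Type} : term C -> term C -> Prop :=
| wh_root t t' : root t t' -> wh t t'
| wh_App t t' u : wh t t' -> wh (App t u) (App t' u)
| wh_Case theta phi t t' :
    wh (Case phi t) t' -> wh (Case theta (Case phi t)) (Case theta t').

Definition reds {C : Type} : term C -> term C -> Prop := clos_refl_trans_1n _ red.
Definition whs {C : Type} : term C -> term C -> Prop := clos_refl_trans_1n _ wh.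

Lemma rt_refl1 (A : Type) (R : relation A) x : clos_refl_trans_1n A R x x.
Proof. constructor. Qed.

Lemma rt_trans1 (A : Type) (R : relation A) x y z :
  clos_refl_trans_1n A R x y -> clos_refl_trans_1n A R y z ->
  clos_refl_trans_1n A R x z.
Proof. induction 1; eauto using clos_refl_trans_1n. Qed.

Lemma rt_step1 (A : Type) (R : relation A) x y :
  R x y -> clos_refl_trans_1n A R x y.
Proof. eauto using clos_refl_trans_1n. Qed.

Lemma rt_map1 (A B : Type) (R : relation A) (Q : relation B) (f : A -> B) x y :
  (forall x y, R x y -> Q (f x) (f y)) ->
  clos_refl_trans_1n A R x y -> clos_refl_trans_1n B Q (f x) (f y).
Proof. intros Hf. induction 1; eauto using clos_refl_trans_1n. Qed.

Lemma wh_red (C : Type) (t t' : term C) : wh t t' -> red t t'.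
Proof. induction 1; eauto using red. Qed.

Lemma whs_reds (C : Type) (t t' : term C) : whs t t' -> reds t t'.
Proof. apply (@rt_map1 _ _ _ _ (fun x => x)), wh_red. Qed.

Lemma reds_Lam (C : Type) (t t' : term C) : reds t t' -> reds (Lam t) (Lam t').
Proof. apply rt_map1. eauto using red. Qed.

Lemma reds_App (C : Type) (t t' u u' : term C) :
  reds t t' -> reds u u' -> reds (App t u) (App t' u').
Proof.
  intros Ht Hu. apply rt_trans1 with (App t' u).
  - revert Ht. apply (@rt_map1 _ _ _ _ (fun x => App x u)). eauto using red.
  - revert Hu. apply rt_map1. eauto using red.
Qed.

Lemma reds_Case (C : Type) (theta : binding C) t t' :
  reds t t' -> reds (Case theta t) (Case theta t').
Proof. apply rt_map1. eauto using red. Qed.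

Lemma reds_binding (C : Type) (theta1 theta2 : binding C) c u u' t :
  reds u u' ->
  reds (Case (theta1 ++ (c, u) :: theta2) t) (Case (theta1 ++ (c, u') :: theta2) t).
Proof.
  apply (@rt_map1 _ _ _ _ (fun x => Case (theta1 ++ (c, x) :: theta2) t)).
  eauto using red.
Qed.

Lemma reds_bmap (C : Type) (f g : term C -> term C) t theta :
  (forall c u, In (c, u) theta -> reds (f u) (g u)) ->
  reds (Case (bmap f theta) t) (Case (bmap g theta) t).
Proof.
  change (bmap f theta) with ([] ++ bmap f theta).
  change (bmap g theta) with ([] ++ bmap g theta).
  (* Branches are reduced from left to right; the prefix collects those already treated. *)
  generalize (@nil (C * term C)) as pre.
  induction theta as [|[c u] theta IH]; intros pre H; [apply rt_refl1|].
  simpl. apply rt_trans1 with (Case (pre ++ (c, g u) :: bmap f theta) t).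
  - apply reds_binding, (H c). left. reflexivity.
  - specialize (IH (pre ++ [(c, g u)])). rewrite <- !app_assoc in IH.
    apply IH. intros d v Hin. apply (H d). right. assumption.
Qed.

Lemma look_bmap (C : Type) (f : term C -> term C) c u theta :
  look c u theta -> look c (f u) (bmap f theta).
Proof. induction 1; simpl; constructor; assumption. Qed.

Lemma look_in (C : Type) c (u : term C) theta : look c u theta -> In (c, u) theta.
Proof. induction 1; simpl; auto. Qed.

Lemma in_dom (C : Type) c (u : term C) theta : In (c, u) theta -> In c (dom theta).
Proof. exact (in_map fst theta (c, u)). Qed.

Lemma dom_look (C : Type) c (theta : binding C) :
  In c (dom theta) -> exists u, look c u theta.
Proof.
  induction theta as [|[d v] theta IH]; simpl; [contradiction|].
  intros H. destruct (classic (d = c)) as [->|Hd].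
  - exists v. constructor.
  - destruct H as [H|H]; [contradiction|]. destruct (IH H) as [u Hu].
    exists u. constructor; assumption.
Qed.

Lemma look_fun (C : Type) c (u v : term C) theta :
  look c u theta -> look c v theta -> u = v.
Proof.
  induction 1; inversion 1; subst; auto; contradiction.
Qed.

Lemma look_replace (C : Type) c (u : term C) theta1 d v theta2 :
  look c u (theta1 ++ (d, v) :: theta2) ->
  (forall v', look c u (theta1 ++ (d, v') :: theta2)) \/
  (u = v /\ forall v', look c v' (theta1 ++ (d, v') :: theta2)).
Proof.
  induction theta1 as [|[e w] theta1 IH]; simpl; intros H; inversion H; subst.
  - right. split; [reflexivity|]. constructor.
  - left. intros v'. constructor; assumption.
  - left. constructor.
  - destruct IH as [IH|[-> IH]]; [assumption|left|right].
    + intros v'. constructor; auto.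
    + split; [reflexivity|]. intros v'. constructor; auto.
Qed.

Lemma root_subst (C : Type) (s : nat -> term C) t t' :
  root t t' -> root (subst s t) (subst s t').
Proof.
  destruct 1; simpl; try constructor.
  - rewrite subst_subst0. constructor.
  - apply (look_bmap (subst s)). assumption.
  - fold (bmap (subst (up s)) (shift_binding theta)).
    rewrite bmap_subst_shift. constructor.
Qed.

Lemma red_subst (C : Type) (t t' : term C) :
  red t t' -> forall s, red (subst s t) (subst s t').
Proof.
  induction 1; intros s; simpl; auto using red.
  - apply red_root, root_subst. assumption.
  - rewrite subst_up_shift. apply red_eta.
  - apply red_stuck. fold (bmap (subst s) theta). rewrite dom_bmap. assumption.
  - rewrite !map_app. simpl. apply red_binding. auto.
Qed.

Lemma red_ren (C : Type) (r : nat -> nat) (t t' : term C) :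
  red t t' -> red (ren r t) (ren r t').
Proof. intros H. rewrite !ren_as_subst. apply red_subst. assumption. Qed.

Lemma reds_subst_r (C : Type) (t : term C) :
  forall s s', (forall x, reds (s x) (s' x)) -> reds (subst s t) (subst s' t).
Proof.
  induction t using term_nested_ind; intros s s' Hs; simpl.
  - apply Hs.
  - apply reds_Lam, IHt. intros [|x]; simpl; [apply rt_refl1|].
    generalize (Hs x). apply rt_map1. intros. apply red_ren. assumption.
  - apply reds_App; auto.
  - apply rt_refl1.
  - apply rt_trans1 with (Case (bmap (subst s') theta) (subst s t)).
    + apply reds_bmap. eauto.
    + apply reds_Case. auto.
  - apply rt_refl1.
Qed.

Lemma red_subst0 (C : Type) (u t t' : term C) :
  red t t' -> red (subst0 u t) (subst0 u t').
Proof. intros H. apply red_subst. assumption. Qed.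

Lemma reds_subst0_r (C : Type) (t u u' : term C) :
  red u u' -> reds (subst0 u t) (subst0 u' t).
Proof.
  intros H. apply reds_subst_r. intros [|x]; [|apply rt_refl1].
  apply rt_step1. assumption.
Qed.

Lemma root_fun (C : Type) (t t1 t2 : term C) : root t t1 -> root t t2 -> t1 = t2.
Proof. destruct 1; inversion 1; subst; eauto using look_fun. Qed.

Lemma wh_fun (C : Type) (t t1 : term C) :
  wh t t1 -> forall t2, wh t t2 -> t1 = t2.
Proof.
  induction 1 as [t t' Hr|t t' u Hw IH|theta phi t t' Hw IH]; intros t2 H2.
  - inversion H2; subst.
    + eauto using root_fun.
    + inversion Hr; subst; inversion H; inversion H0.
    + inversion Hr.
  - inversion H2; subst.
    + inversion H; subst; inversion Hw; inversion H0.
    + f_equal. auto.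
  - inversion H2; subst.
    + inversion H.
    + f_equal. auto.
Qed.

Lemma red_Case_inv (C : Type) (theta : binding C) t r :
  red (Case theta t) r ->
  root (Case theta t) r \/ exists theta' t', r = Case theta' t'.
Proof. inversion 1; subst; eauto. Qed.

Lemma shift_binding_app (C : Type) (theta1 theta2 : binding C) c u :
  shift_binding (theta1 ++ (c, u) :: theta2) =
  shift_binding theta1 ++ (c, shift u) :: shift_binding theta2.
Proof. unfold shift_binding. rewrite map_app. reflexivity. Qed.

(** Another reduction either leads to a term that [s'] reaches anyway (same redex, or a critical
    pair), or leaves the weak head redex in place. That a single weak head step then suffices is
    what lets the expansion lemmas argue by induction on strong normalisation. *)
Lemma wh_red_commute (C : Type) (s s' : term C) :
  wh s s' -> forall r, red s r ->
  reds s' r \/ exists r', wh r r' /\ reds s' r'.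
Proof.
  induction 1 as [s s' Hr|t t' u Hw IH|theta phi t t' Hw IH]; intros r Hred.
  - destruct Hr.
    + inversion Hred; subst.
      * left. rewrite (root_fun H (root_beta t u)). apply rt_refl1.
      * inversion H2; subst.
        -- inversion H.
        (* Eta inside the redex: contracting beta or eta gives the same term [App t' u]. *)
        -- left. unfold subst0. simpl. fold (subst0 u (shift t')).
           rewrite subst0_shift. apply rt_refl1.
        -- right. exists Dai. split; [repeat constructor|apply rt_refl1].
        -- right. eexists. split; [repeat constructor|].
           apply rt_step1, red_subst0. assumption.
      * right. eexists. split; [repeat constructor|].
        apply reds_subst0_r. assumption.
    + inversion Hred; subst.
      * inversion H; subst. left. apply rt_refl1.
      * inversion H2. inversion H.
      * right. exists Dai. split; [repeat constructor|apply rt_refl1].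
    + inversion Hred; subst.
      * left. rewrite (root_fun H0 (root_case_con H)). apply rt_refl1.
      * exfalso. eauto using look_in, in_dom.
      * match goal with
        | H : red (Con c) _ |- _ => inversion H as [? ? Hroot| | | | | | | |]
        end.
        inversion Hroot.
      (* The reduced branch is either not the selected one or exactly it. *)
      * destruct (look_replace _ _ _ _ H) as [H1|[-> H1]]; right.
        -- exists u. split; [apply wh_root, root_case_con, H1|apply rt_refl1].
        -- exists u'. split; [apply wh_root, root_case_con, H1|].
           apply rt_step1. assumption.
    + inversion Hred; subst.
      * inversion H; subst. left. apply rt_refl1.
      * inversion H2. inversion H.
      * right. exists Dai. split; [repeat constructor|apply rt_refl1].
    + inversion Hred; subst.
      * inversion H; subst. left. apply rt_refl1.
      * inversion H2; subst.
        -- inversion H; subst.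
           (* Beta below the case: once the case has moved onto the abstraction, pushing it under
              the binder and contracting catches up. *)
           ++ left. eapply rt_trans1; apply rt_step1.
              ** apply red_App_l, red_root. constructor.
              ** rewrite <- subst0_case_shift. apply red_root. constructor.
           ++ right. exists Dai. split; [repeat constructor|].
              eapply rt_trans1; apply rt_step1.
              ** apply red_App_l, red_root. constructor.
              ** apply red_root. constructor.
        -- right. eexists. split; [repeat constructor|].
           apply rt_step1. auto using red.
        -- right. eexists. split; [repeat constructor|].
           apply rt_step1. auto using red.
      * right. eexists. split; [repeat constructor|].
        apply rt_step1. auto using red.
    + inversion Hred; subst.
      * inversion H; subst. left. apply rt_refl1.
      * inversion H2; subst.
        -- inversion H.
        (* Eta below the case: commuting the case with the application exposes an eta-redex
           again. *)
        -- left. eapply rt_trans1; apply rt_step1.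
           ++ apply red_Lam, red_root. constructor.
           ++ apply (red_eta (Case theta t')).
        -- right. exists Dai. split; [repeat constructor|].
           eapply rt_trans1; apply rt_step1.
           ++ apply red_Lam, red_root. constructor.
           ++ apply red_lam_dai.
        -- right. eexists. split; [repeat constructor|].
           apply rt_step1. auto using red.
      * right. eexists. split; [repeat constructor|].
        apply rt_step1. rewrite !shift_binding_app.
        apply red_Lam, red_binding, red_ren. assumption.
  - inversion Hred; subst.
    + inversion H; subst; inversion Hw; inversion H0.
    + destruct (IH _ H2) as [H|[r' [H H']]].
      * left. apply reds_App; [assumption|apply rt_refl1].
      * right. exists (App r' u). split; [apply wh_App; assumption|].
        apply reds_App; [assumption|apply rt_refl1].
    + right. eexists. split; [apply wh_App; eassumption|].
      apply rt_step1, red_App_r. assumption.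
  - inversion Hred; subst.
    + inversion H.
    (* A reduct of the inner case is its weak head reduct, by determinism, or is still a case, so
       that [wh_Case] remains applicable. *)
    + destruct (red_Case_inv H2) as [H|[phi' [t1 ->]]].
      * rewrite (wh_fun Hw (wh_root H)). left. apply rt_refl1.
      * destruct (IH _ H2) as [H|[r' [H H']]].
        -- left. apply reds_Case. assumption.
        -- right. exists (Case theta r'). split; [apply wh_Case; assumption|].
           apply reds_Case. assumption.
    + right. eexists. split; [apply wh_Case; eassumption|].
      apply rt_step1, red_binding. assumption.
Qed.

(** * Strong normalisation *)

Definition sn {C : Type} : term C -> Prop := Acc (fun t' t => red t t').

Lemma sn_intro (C : Type) (t : term C) : (forall t', red t t' -> sn t') -> sn t.
Proof. exact (Acc_intro t). Qed.

Lemma sn_red (C : Type) (t t' : term C) : sn t -> red t t' -> sn t'.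
Proof. intros [H] Hr. exact (H _ Hr). Qed.

Lemma sn_reds (C : Type) (t t' : term C) : sn t -> reds t t' -> sn t'.
Proof. intros Ht. induction 1; eauto using sn_red. Qed.

(** An infinite reduction of [t] would be carried by [f] to one of [f t]. *)
Lemma sn_preimage (C : Type) (f : term C -> term C) :
  (forall t t', red t t' -> red (f t) (f t')) -> forall t, sn (f t) -> sn t.
Proof.
  intros Hf t Ht. remember (f t) as a eqn:E. revert t E.
  induction Ht as [a _ IH]. intros t ->.
  apply sn_intro. intros t' Hr. eapply IH; [apply Hf; eassumption|reflexivity].
Qed.

Lemma sn_subst_inv (C : Type) (s : nat -> term C) t : sn (subst s t) -> sn t.
Proof. apply sn_preimage. intros. apply red_subst. assumption. Qed.

Lemma sn_shift_inv (C : Type) (t : term C) : sn (shift t) -> sn t.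
Proof. apply sn_preimage. intros. apply red_ren. assumption. Qed.

Lemma sn_shift (C : Type) (t : term C) : sn t -> sn (shift t).
Proof.
  intros Ht. rewrite <- (subst0_shift Dai t) in Ht. exact (sn_subst_inv _ _ Ht).
Qed.

Lemma sn_App_l (C : Type) (t u : term C) : sn (App t u) -> sn t.
Proof. apply (sn_preimage (fun x => App x u)). auto using red. Qed.

Lemma sn_App_r (C : Type) (t u : term C) : sn (App t u) -> sn u.
Proof. apply sn_preimage. auto using red. Qed.

Lemma sn_Dai (C : Type) : sn (@Dai C).
Proof. apply sn_intro. inversion 1. inversion H0. Qed.

Lemma sn_Con (C : Type) (c : C) : sn (Con c).
Proof. apply sn_intro. inversion 1. inversion H0. Qed.

Lemma sn_Lam (C : Type) (t : term C) : sn t -> sn (Lam t).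
Proof.
  intros Ht. generalize Ht. induction Ht as [t _ IH]. intros Ht.
  apply sn_intro. intros r Hr. inversion Hr; subst.
  - inversion H.
  - exact (sn_shift_inv _ (sn_App_l Ht)).
  - apply sn_Dai.
  - apply IH; [assumption|]. eauto using sn_red.
Qed.

Lemma sn_Dai_app (C : Type) (u : term C) : sn u -> sn (App Dai u).
Proof.
  induction 1 as [u _ IH]. apply sn_intro. intros r Hr. inversion Hr; subst.
  - inversion H; subst. apply sn_Dai.
  - inversion H2. inversion H.
  - auto.
Qed.

(** Lexicographic induction on the normalisation of [t] and [u]. That of [u] is asked for separately
    because the bound variable may not occur in [t]. *)
Lemma sn_beta_expand (C : Type) (t u : term C) :
  sn t -> sn u -> sn (subst0 u t) -> sn (App (Lam t) u).
Proof.
  intros Ht. revert u. induction Ht as [t _ IHt]. intros u Hu.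
  generalize Hu. induction Hu as [u _ IHu]. intros Hu Hs.
  apply sn_intro. intros r Hr. inversion Hr; subst.
  - inversion H; subst. assumption.
  - inversion H2; subst.
    + inversion H.
    + unfold subst0 in Hs. simpl in Hs. fold (subst0 u (shift t')) in Hs.
      rewrite subst0_shift in Hs. assumption.
    + apply sn_Dai_app. assumption.
    + apply IHt; auto. eapply sn_red; [eassumption|]. apply red_subst0. assumption.
  - apply IHu; auto.
    + eauto using sn_red.
    + eapply sn_reds; [eassumption|]. apply reds_subst0_r. assumption.
Qed.

(** Since [t] has a weak head step it is neither an abstraction nor [Dai], so [App t u] is no root
    redex; reductions inside [t] are handled by [wh_red_commute]. *)
Lemma sn_wh_expand_app (C : Type) (t : term C) :
  sn t -> forall t' u, wh t t' -> sn (App t' u) -> sn (App t u).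
Proof.
  induction 1 as [t _ IHt]. intros t' u Hw Hs.
  pose proof (sn_App_r Hs) as Hu. revert Hs.
  induction Hu as [u _ IHu]. intros Hs.
  apply sn_intro. intros r Hr. inversion Hr; subst.
  - inversion H; subst; inversion Hw; inversion H0.
  - destruct (wh_red_commute Hw H2) as [H|[r' [H H']]].
    + eapply sn_reds; [eassumption|]. apply reds_App; [assumption|apply rt_refl1].
    + eapply IHt; eauto. eapply sn_reds; [eassumption|].
      apply reds_App; [assumption|apply rt_refl1].
  - apply IHu; [assumption|]. eapply sn_red; [eassumption|]. auto using red.
Qed.

Lemma sn_whs_expand_app (C : Type) (t t' u : term C) :
  sn t -> whs t t' -> sn (App t' u) -> sn (App t u).
Proof.
  intros Ht Hw Hs. induction Hw as [t|t t1 t' Hw _ IH]; [assumption|].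
  eapply sn_wh_expand_app; eauto. apply IH; auto. eauto using sn_red, wh_red.
Qed.

(** Reductions in [theta] and in the body are mirrored by the term with the case already under the
    binder; only root, eta and daimon steps remain. *)
Lemma sn_case_lam (C : Type) (theta : binding C) t :
  sn (Case (shift_binding theta) t) -> sn (Case theta (Lam t)).
Proof.
  intros Ht. remember (Case (shift_binding theta) t) as a eqn:E.
  revert theta t E. induction Ht as [a Ha IH]. intros theta t ->.
  assert (Hsn : sn (Case (shift_binding theta) t)) by (constructor; assumption).
  apply sn_intro. intros r Hr. inversion Hr; subst.
  - inversion H; subst. apply sn_Lam. assumption.
  - inversion H2; subst.
    + inversion H.
    (* The shift of the eta-reduct [Case theta t'] is the function part obtained by commuting the
       inner case with the application. *)
    + apply sn_shift_inv. eapply sn_App_l, sn_red; [exact Hsn|].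
      apply red_root. constructor.
    + apply (@sn_shift_inv C (Case theta Dai)). assumption.
    + eapply IH; [|reflexivity]. auto using red.
  - eapply IH; [|reflexivity]. rewrite !shift_binding_app.
    apply red_binding, red_ren. assumption.
Qed.

Lemma whs_App (C : Type) (t t' u : term C) : whs t t' -> whs (App t u) (App t' u).
Proof.
  apply (@rt_map1 _ _ _ _ (fun x => App x u)). intros. apply wh_App. assumption.
Qed.

(** [Case theta] does not preserve weak head steps, because it first moves past an application; a
    common weak head reduct replaces preservation. *)
Lemma case_wh_join (C : Type) (theta : binding C) t t' :
  wh t t' -> exists m, whs (Case theta t) m /\ whs (Case theta t') m.
Proof.
  induction 1 as [t t' Hr|t t' u Hw [m [IH1 IH2]]|phi phi' t t' Hw _].
  - destruct Hr.
    + eexists. split; [|apply rt_refl1].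
      eapply rt_trans1; [apply rt_step1; repeat constructor|].
      eapply rt_trans1; [apply rt_step1, wh_App; repeat constructor|].
      rewrite <- subst0_case_shift. apply rt_step1. repeat constructor.
    + exists Dai. split; [|apply rt_step1; repeat constructor].
      eapply rt_trans1; [apply rt_step1; repeat constructor|].
      eapply rt_trans1; [apply rt_step1, wh_App; repeat constructor|].
      apply rt_step1. repeat constructor.
    + eexists. split; [|apply rt_refl1]. apply rt_step1, wh_Case, wh_root.
      constructor. assumption.
    + eexists. split; [|apply rt_refl1]. apply rt_step1, wh_Case, wh_root. constructor.
    + eexists. split; [|apply rt_refl1]. apply rt_step1, wh_Case, wh_root. constructor.
    + eexists. split; [|apply rt_refl1]. apply rt_step1, wh_Case, wh_root. constructor.
  - exists (App m u). split.
    + eapply rt_trans1; [apply rt_step1; repeat constructor|]. apply whs_App. assumption.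
    + eapply rt_trans1; [apply rt_step1; repeat constructor|]. apply whs_App. assumption.
  - eexists. split; [|apply rt_refl1]. apply rt_step1, wh_Case, wh_Case. assumption.
Qed.

Lemma whs_linear (C : Type) (t a b : term C) :
  whs t a -> whs t b -> whs a b \/ whs b a.
Proof.
  intros Ha. revert b. induction Ha as [t|t t1 a Hw Ha IH]; intros b Hb.
  - left. assumption.
  - destruct Hb as [|t2 b Hw' Hb].
    + right. econstructor; eassumption.
    + rewrite <- (wh_fun Hw Hw') in Hb. auto.
Qed.

(** The joins of two consecutive stages are weak head reducts of one term, hence comparable by
    determinism; the later one serves both. *)
Lemma case_whs_join (C : Type) (theta : binding C) t t' :
  whs t t' -> exists m, whs (Case theta t) m /\ whs (Case theta t') m.
Proof.
  induction 1 as [t|t t1 t' Hw _ [m [H1 H2]]].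
  - exists (Case theta t). split; apply rt_refl1.
  - destruct (case_wh_join theta Hw) as [n [H3 H4]].
    destruct (whs_linear H1 H4) as [H|H].
    + exists n. split; [assumption|]. eapply rt_trans1; eassumption.
    + exists m. split; [|assumption]. eapply rt_trans1; eassumption.
Qed.

Definition apps {C : Type} (t : term C) (us : list (term C)) : term C :=
  fold_left (@App C) us t.

Lemma apps_snoc (C : Type) (t u : term C) us :
  apps t (us ++ [u]) = App (apps t us) u.
Proof. apply fold_left_app. Qed.

Lemma red_apps (C : Type) us : forall t t' : term C,
  red t t' -> red (apps t us) (apps t' us).
Proof. induction us as [|u us IH]; intros t t' H; simpl; auto using red. Qed.

Lemma whs_apps (C : Type) us : forall t t' : term C,
  whs t t' -> whs (apps t us) (apps t' us).
Proof. induction us as [|u us IH]; intros t t' H; simpl; auto using whs_App. Qed.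

(** Expansion under [Case theta] recurses into the function part of an
    application because [Case theta] commutes with [App]. *)
Definition red_or_fun {C : Type} (t' t : term C) : Prop :=
  red t t' \/ exists u, t = App t' u.

(** Generalised to the head [p] of a normalising spine [apps p us]: reducing [p] reduces the spine,
    while passing to the function part of [p] only moves an argument into [us] and descends
    structurally. *)
Lemma sn_acc_red_or_fun (C : Type) (t : term C) : sn t -> Acc red_or_fun t.
Proof.
  intros Ht.
  assert (H : forall p us, t = apps p us -> Acc red_or_fun p);
    [|exact (H t [] eq_refl)].
  induction Ht as [t _ IH].
  induction p; intros us ->; constructor; intros p' [Hr|[v E]];
    try discriminate; try (eapply IH; [apply red_apps; eassumption|reflexivity]).
  injection E as -> ->. apply (IHp1 (v :: us)). reflexivity.
Qed.

(** The outer induction along [red_or_fun] handles [t]; the inner one, on the normalisation of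
    [Case theta t'], handles reductions in [theta]. *)
Lemma sn_wh_expand_case (C : Type) (t : term C) :
  sn t -> forall theta t', wh t t' -> sn (Case theta t') -> sn (Case theta t).
Proof.
  intros Ht. pose proof (sn_acc_red_or_fun Ht) as Hacc. revert Ht.
  induction Hacc as [t _ IHt]. intros Ht theta t' Hw Hs.
  remember (Case theta t') as a eqn:E. revert theta E.
  induction Hs as [a Ha IHa]. intros theta ->.
  assert (Hs : sn (Case theta t')) by (constructor; assumption).
  apply sn_intro. intros r Hr. inversion Hr; subst.
  (* Constructors, abstractions and [Dai] have no weak head step, so the only root step left is
     commutation with an application. *)
  - inversion H; subst; try (inversion Hw; subst; inversion H0; fail).
    inversion Hw; subst.
    + inversion H0; subst.
      (* The normalising term is an instance of the case pushed under the binder, which therefore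
         normalises as well. *)
      * rewrite <- subst0_case_shift in Hs.
        pose proof (sn_subst_inv _ _ Hs) as Hb.
        eapply sn_wh_expand_app.
        -- apply sn_case_lam. eassumption.
        -- apply wh_root. constructor.
        -- apply sn_beta_expand; auto. exact (sn_App_r Ht).
      * eapply sn_wh_expand_app; [eassumption| |eassumption].
        apply wh_root. constructor.
    (* The weak head step lies in the function part, to which the outer induction hypothesis
       applies; the two sides meet at the join [m]. *)
    + assert (Hs' : sn (App (Case theta t'0) u)).
      { eapply sn_red; [exact Hs|]. apply red_root. constructor. }
      destruct (case_wh_join theta H3) as [m [H1 H2]].
      eapply sn_whs_expand_app; [|eassumption|].
      * eapply IHt; [right; eauto|exact (sn_App_l Ht)|eassumption|].
        exact (sn_App_l Hs').
      * eapply sn_reds; [exact Hs'|]. apply whs_reds, whs_App. assumption.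
  - inversion Hw. inversion H.
  - destruct (wh_red_commute Hw H2) as [H|[r' [H H']]].
    + eapply sn_reds; [exact Hs|]. apply reds_Case. assumption.
    + eapply IHt; [left; eassumption|eauto using sn_red|eassumption|].
      eapply sn_reds; [exact Hs|]. apply reds_Case. assumption.
  - eapply IHa; [|reflexivity]. auto using red.
Qed.

Lemma sn_whs_expand_case (C : Type) (theta : binding C) t t' :
  sn t -> whs t t' -> sn (Case theta t') -> sn (Case theta t).
Proof.
  intros Ht Hw Hs. induction Hw as [t|t t1 t' Hw _ IH]; [assumption|].
  eapply sn_wh_expand_case; eauto. apply IH; auto. eauto using sn_red, wh_red.
Qed.

(** * Normalisation of case bindings and of cases on atoms *)

Definition red_bind {C : Type} (theta' theta : binding C) : Prop :=
  exists theta1 c u u' theta2, theta = theta1 ++ (c, u) :: theta2 /\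
    theta' = theta1 ++ (c, u') :: theta2 /\ red u u'.

(** Each step reduces one branch, so nested inductions on the first branch and on the remaining ones
    suffice. *)
Lemma sn_binding (C : Type) (theta : binding C) :
  (forall c u, In (c, u) theta -> sn u) -> Acc red_bind theta.
Proof.
  induction theta as [|[c u] theta IH]; intros H.
  - constructor. intros theta' [[|? ?] [? [? [? [? [E _]]]]]]; discriminate.
  - assert (Hu : sn u) by (apply (H c); left; reflexivity).
    assert (Ht : Acc red_bind theta).
    { apply IH. intros d v Hin. apply (H d). right. assumption. }
    clear IH H. revert theta Ht. induction Hu as [u _ IHu].
    intros theta Ht. pose proof Ht as Ht0.
    induction Ht as [theta _ IHt].
    constructor. intros theta' [theta1 [d [v [v' [theta2 [E [-> Hr]]]]]]].
    destruct theta1 as [|[e w] theta1]; simpl in *; injection E as -> -> ->.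
    + apply IHu; assumption.
    + assert (Hb : red_bind (theta1 ++ (d, v') :: theta2) (theta1 ++ (d, v) :: theta2))
        by (repeat eexists; assumption).
      apply IHt; [assumption|]. exact (Acc_inv Ht0 Hb).
Qed.

Lemma sn_case_dai (C : Type) (theta : binding C) :
  (forall c u, In (c, u) theta -> sn u) -> sn (Case theta Dai).
Proof.
  intros H. apply sn_binding in H. induction H as [theta _ IH].
  apply sn_intro. intros r Hr. inversion Hr; subst.
  - inversion H; subst. apply sn_Dai.
  - inversion H2. inversion H.
  - apply IH. repeat eexists. assumption.
Qed.

Lemma sn_case_var (C : Type) (theta : binding C) x :
  (forall c u, In (c, u) theta -> sn u) -> sn (Case theta (Var x)).
Proof.
  intros H. apply sn_binding in H. induction H as [theta _ IH].
  apply sn_intro. intros r Hr. inversion Hr; subst.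
  - inversion H.
  - inversion H2. inversion H.
  - apply IH. repeat eexists. assumption.
Qed.

Lemma sn_case_con (C : Type) (theta : binding C) c u :
  (forall d v, In (d, v) theta -> sn v) -> look c u theta -> sn (Case theta (Con c)).
Proof.
  intros H Hl. pose proof (H _ _ (look_in Hl)) as Hu.
  (* The branch [u] is generalised, since reducing [theta] may reduce the selected branch itself. *)
  apply sn_binding in H. revert u Hl Hu. induction H as [theta _ IH].
  intros u Hl Hu. apply sn_intro. intros r Hr. inversion Hr; subst.
  - rewrite (root_fun H (root_case_con Hl)). assumption.
  (* A matching branch rules out the loop of [red_stuck]. *)
  - exfalso. eauto using look_in, in_dom.
  - inversion H2. inversion H.
  - destruct (look_replace _ _ _ _ Hl) as [H1|[-> H1]].
    + apply (IH (theta1 ++ (c0, u') :: theta2)) with u; auto.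
      repeat eexists. assumption.
    + apply (IH (theta1 ++ (c0, u') :: theta2)) with u'; auto.
      * repeat eexists. assumption.
      * eapply sn_red; eassumption.
Qed.

Lemma sn_apps_case_con (C : Type) (theta : binding C) c u us :
  sn (Case theta (Con c)) -> look c u theta -> sn (apps u us) ->
  sn (apps (Case theta (Con c)) us).
Proof.
  intros Hc Hl. induction us as [|v us IH] using rev_ind; [auto|].
  rewrite !apps_snoc. intros Hs. eapply sn_whs_expand_app; [| |eassumption].
  - apply IH. exact (sn_App_l Hs).
  - apply whs_apps, rt_step1, wh_root. constructor. assumption.
Qed.

(** * Constructor values *)

Definition data_value {C : Type} (t : term C) : Prop :=
  exists c us, t = apps (Con c) us.

Lemma data_value_red (C : Type) (t t' : term C) :
  data_value t -> red t t' -> data_value t'.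
Proof.
  intros [c [us ->]]. revert t'.
  induction us as [|u us IH] using rev_ind; intros t' Hr.
  - inversion Hr. inversion H.
  - rewrite apps_snoc in Hr. inversion Hr; subst.
    + exfalso. destruct us as [|v us] using rev_ind; [|rewrite apps_snoc in H];
        inversion H.
    + destruct (IH _ H2) as [d [vs ->]]. exists d, (vs ++ [u]).
      symmetry. apply apps_snoc.
    + exists c, (us ++ [u']). symmetry. apply apps_snoc.
Qed.

Lemma data_value_App_root (C : Type) (t u r : term C) :
  data_value t -> ~ root (App t u) r.
Proof.
  intros [c [us ->]] H. destruct us as [|v us] using rev_ind;
    [|rewrite apps_snoc in H]; inversion H.
Qed.

Lemma data_value_App (C : Type) (t u : term C) :
  data_value t -> data_value (App t u).
Proof.
  intros [c [us ->]]. exists c, (us ++ [u]). symmetry. apply apps_snoc.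
Qed.

Lemma data_value_normal (C : Type) (t t' : term C) : data_value t -> ~ wh t t'.
Proof.
  intros [c [us ->]]. revert t'.
  induction us as [|u us IH] using rev_ind; intros t' Hw.
  - inversion Hw. inversion H.
  - rewrite apps_snoc in Hw. inversion Hw; subst.
    + revert H. apply data_value_App_root. exists c, us. reflexivity.
    + eapply IH. eassumption.
Qed.

Lemma sn_data_value_App (C : Type) (t u : term C) :
  data_value t -> sn t -> sn u -> sn (App t u).
Proof.
  intros Hd Ht. revert Hd u. induction Ht as [t _ IHt].
  intros Hd u Hu. pose proof Hu as Hu0. induction Hu as [u _ IHu].
  apply sn_intro. intros r Hr. inversion Hr; subst.
  - exfalso. revert H. apply data_value_App_root. assumption.
  - apply IHt; auto. eapply data_value_red; eassumption.
  - apply IHu; [assumption|]. eapply sn_red; eassumption.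
Qed.

(** With a constructor value as function part the application is never a redex, so every reduction
    is mirrored after the commutation. *)
Lemma sn_case_data_value_App (C : Type) (theta : binding C) t u :
  data_value t -> sn (App (Case theta t) u) -> sn (Case theta (App t u)).
Proof.
  intros Hd Hs. remember (App (Case theta t) u) as a eqn:E.
  revert theta t u Hd E. induction Hs as [a Ha IH]. intros theta t u Hd ->.
  apply sn_intro. intros r Hr. inversion Hr; subst.
  - inversion H; subst. constructor. assumption.
  - inversion H2; subst.
    + exfalso. revert H. apply data_value_App_root. assumption.
    + eapply IH; [|eapply data_value_red; eassumption|reflexivity]. auto using red.
    + eapply IH; [|assumption|reflexivity]. auto using red.
  - eapply IH; [|assumption|reflexivity]. auto using red.
Qed.

Lemma whs_case_apps (C : Type) (theta : binding C) us : forall t,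
  whs (Case theta (apps t us)) (apps (Case theta t) us).
Proof.
  induction us as [|u us IH] using rev_ind; intros t; [apply rt_refl1|].
  rewrite !apps_snoc. eapply rt_trans1; [apply rt_step1|apply whs_App, IH].
  apply wh_root. constructor.
Qed.

Lemma sn_case_apps_con (C : Type) (theta : binding C) c us :
  sn (apps (Case theta (Con c)) us) -> sn (Case theta (apps (Con c) us)).
Proof.
  induction us as [|u us IH] using rev_ind; [auto|].
  rewrite !apps_snoc. intros Hs. apply sn_case_data_value_App.
  - exists c, us. reflexivity.
  - eapply sn_whs_expand_app; [|apply whs_case_apps|assumption].
    apply IH. exact (sn_App_l Hs).
Qed.

(** * Saturated sets *)

(** Closure under weak head expansion, in place of the usual condition on all
    reducts of a neutral term, makes saturated sets stable under union. *)
Definition saturated {C : Type} (A : term C -> Prop) : Prop :=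
  (forall t, A t -> sn t) /\ A Dai /\
  (forall t t', wh t t' -> A t -> A t') /\
  (forall t t', wh t t' -> sn t -> A t' -> A t).

(** The extra demand on data types: [sub_data] needs a value from which the application type can be
    read off. *)
Definition data_like {C : Type} (A : term C -> Prop) : Prop :=
  forall t, A t -> exists v, whs t v /\ (v = Dai \/ data_value v).

Definition candidate {C : Type} (k : kind) (A : term C -> Prop) : Prop :=
  saturated A /\ (k = Dat -> data_like A).

Lemma saturated_whs (C : Type) (A : term C -> Prop) t t' :
  saturated A -> whs t t' -> A t -> A t'.
Proof. intros [_ [_ [H _]]]. induction 1; eauto. Qed.

Lemma saturated_whs_expand (C : Type) (A : term C -> Prop) t t' :
  saturated A -> whs t t' -> sn t -> A t' -> A t.
Proof.
  intros HA. induction 1 as [t|t t1 t' Hw _ IH]; [auto|]. intros Ht Ht'.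
  destruct HA as [H1 [_ [_ H]]]. apply H with t1; auto.
  apply IH; [|assumption]. exact (sn_red Ht (wh_red Hw)).
Qed.

Lemma Dai_normal (C : Type) (t : term C) : ~ wh Dai t.
Proof. intros H. inversion H. inversion H0. Qed.

Lemma value_unique (C : Type) (t v w : term C) :
  whs t v -> whs t w -> v = Dai \/ data_value v -> w = Dai \/ data_value w -> v = w.
Proof.
  intros Hv Hw Nv Nw.
  assert (N : forall a b : term C, a = Dai \/ data_value a -> whs a b -> a = b).
  { intros a b Na [|c d Hc _]; [reflexivity|exfalso].
    destruct Na as [->|Na]; [exact (Dai_normal Hc)|exact (data_value_normal Na Hc)]. }
  destruct (whs_linear Hv Hw) as [H|H]; [|symmetry]; eauto.
Qed.

Lemma data_value_not_Dai (C : Type) (t : term C) : data_value t -> t <> Dai.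
Proof.
  intros [c [us ->]]. destruct us as [|u us] using rev_ind;
    [|rewrite apps_snoc]; discriminate.
Qed.

Lemma whs_Dai_data_value (C : Type) (t v : term C) :
  whs t Dai -> whs t v -> data_value v -> False.
Proof.
  intros H1 H2 Hv. apply (data_value_not_Dai Hv).
  eapply value_unique; eauto.
Qed.

Lemma apps_Con_inj (C : Type) (c d : C) us : forall vs,
  apps (Con c) us = apps (Con d) vs -> c = d.
Proof.
  induction us as [|u us IH] using rev_ind; intros vs;
    destruct vs as [|v vs _] using rev_ind; rewrite ?apps_snoc; simpl;
    try discriminate; intros H; injection H; eauto.
Qed.

(** A data type is determined by its set [P] of values other than [Dai], which
    belongs to every type. *)
Definition evaluates {C : Type} (P : term C -> Prop) (t : term C) : Prop :=
  sn t /\ (whs t Dai \/ exists v, whs t v /\ data_value v /\ P v).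

Lemma whs_wh_value (C : Type) (t t' v : term C) :
  wh t t' -> whs t v -> v = Dai \/ data_value v -> whs t' v.
Proof.
  intros Hw Hv Nv. destruct Hv as [|t1 v Hw' Hv].
  - exfalso. destruct Nv as [->|Nv]; [exact (Dai_normal Hw)|].
    exact (data_value_normal Nv Hw).
  - rewrite (wh_fun Hw Hw'). assumption.
Qed.

Lemma evaluates_candidate (C : Type) k (P : term C -> Prop) :
  candidate k (evaluates P).
Proof.
  split; [|intros _ t [_ [H|[v [H [Hv _]]]]]; eauto].
  split; [|split; [|split]].
  - intros t [H _]. assumption.
  - split; [apply sn_Dai|left; apply rt_refl1].
  - intros t t' Hw [Ht H]. split; [exact (sn_red Ht (wh_red Hw))|].
    destruct H as [H|[v [H [Hv HP]]]]; [left|right]; eauto using whs_wh_value.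
    exists v. eauto using whs_wh_value.
  - intros t t' Hw Ht [_ H]. split; [assumption|].
    destruct H as [H|[v [H [Hv HP]]]]; [left|right]; [econstructor; eassumption|].
    exists v. split; [econstructor; eassumption|auto].
Qed.

(** The least candidate of either kind: closure under expansion puts these terms in every saturated
    set. *)
Definition bot {C : Type} : term C -> Prop := evaluates (fun _ => False).

Lemma bot_whs (C : Type) (t : term C) : bot t -> whs t Dai.
Proof. intros [_ [H|[v [_ [_ []]]]]]. assumption. Qed.

Lemma bot_candidate (C : Type) k : candidate k (@bot C).
Proof. apply evaluates_candidate. Qed.

(** * Interpretation of types *)

Definition valuation (C : Type) : Type := kind -> nat -> term C -> Prop.

Definition extend {C : Type} (k : kind) (A : term C -> Prop) (rho : valuation C)
    (k' : kind) (n : nat) : term C -> Prop :=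
  if kind_eqb k k' then match n with 0 => A | S m => rho k' m end else rho k' n.

Fixpoint interp {C : Type} (rho : valuation C) (T : type C) : term C -> Prop :=
  match T with
  | TVar k n => rho k n
  | TCon c => evaluates (fun v => v = Con c)
  | TApp D T =>
      evaluates (fun v => exists p u, v = App p u /\ interp rho D p /\ interp rho T u)
  | TArr T U => fun t => forall u, interp rho T u -> interp rho U (App t u)
  | TCup T U => fun t => interp rho T t \/ interp rho U t
  | TCap T U => fun t => interp rho T t /\ interp rho U t
  | TAll k T => fun t => forall A, candidate k A -> interp (extend k A rho) T t
  | TEx k T => fun t => exists A, candidate k A /\ interp (extend k A rho) T t
  end.

Definition adequate {C : Type} (rho : valuation C) : Prop :=
  forall k n, candidate k (rho k n).

Lemma adequate_extend (C : Type) k (A : term C -> Prop) rho :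
  candidate k A -> adequate rho -> adequate (extend k A rho).
Proof.
  intros HA Hr k' n. unfold extend.
  destruct k, k'; simpl; auto; destruct n; auto.
Qed.

Lemma interp_saturated (C : Type) (T : type C) :
  forall rho, adequate rho -> saturated (interp rho T).
Proof.
  induction T; intros rho Hr; simpl.
  - apply Hr.
  - exact (proj1 (evaluates_candidate Ord _)).
  - exact (proj1 (evaluates_candidate Ord _)).
  - destruct (IHT1 rho Hr) as [A1 [A2 [A3 A4]]].
    destruct (IHT2 rho Hr) as [B1 [B2 [B3 B4]]].
    split; [|split; [|split]].
    (* [Dai] is the argument available in every saturated set. *)
    + intros t Ht. exact (sn_App_l (B1 _ (Ht _ A2))).
    + intros u Hu. apply B4 with Dai; auto.
      * apply wh_root. constructor.
      * apply sn_Dai_app. auto.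
    + intros t t' Hw Ht u Hu. apply B3 with (App t u); auto.
      apply wh_App. assumption.
    + intros t t' Hw Ht Ht' u Hu. apply B4 with (App t' u); auto.
      * apply wh_App. assumption.
      * apply sn_wh_expand_app with t'; auto.
  - destruct (IHT1 rho Hr) as [A1 [A2 [A3 A4]]].
    destruct (IHT2 rho Hr) as [B1 [B2 [B3 B4]]].
    split; [|split; [|split]].
    + intros t [H|H]; auto.
    + auto.
    + intros t t' Hw [H|H]; eauto.
    + intros t t' Hw Ht [H|H]; eauto.
  - destruct (IHT1 rho Hr) as [A1 [A2 [A3 A4]]].
    destruct (IHT2 rho Hr) as [B1 [B2 [B3 B4]]].
    split; [|split; [|split]].
    + intros t [H _]; auto.
    + auto.
    + intros t t' Hw [H1 H2]; eauto.
    + intros t t' Hw Ht [H1 H2]; eauto.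
  - pose proof (fun A HA => IHT _ (@adequate_extend C k A rho HA Hr)) as H.
    split; [|split; [|split]].
    (* Normalisation needs just one instance of the quantifier; [bot] is a candidate of both
       kinds. *)
    + intros t Ht. exact (proj1 (H _ (bot_candidate _ k)) t (Ht _ (bot_candidate _ k))).
    + intros A HA. apply (H A HA).
    + intros t t' Hw Ht A HA. destruct (H A HA) as [_ [_ [H3 _]]]. eauto.
    + intros t t' Hw Hs Ht A HA. destruct (H A HA) as [_ [_ [_ H4]]]. eauto.
  - pose proof (fun A HA => IHT _ (@adequate_extend C k A rho HA Hr)) as H.
    split; [|split; [|split]].
    + intros t [A [HA Ht]]. exact (proj1 (H A HA) t Ht).
    + exists bot. split; [apply bot_candidate|]. apply (H _ (bot_candidate _ k)).
    + intros t t' Hw [A [HA Ht]]. exists A. split; [assumption|].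
      destruct (H A HA) as [_ [_ [H3 _]]]. eauto.
    + intros t t' Hw Hs [A [HA Ht]]. exists A. split; [assumption|].
      destruct (H A HA) as [_ [_ [_ H4]]]. eauto.
Qed.

Lemma interp_data_like (C : Type) (T : type C) :
  wf_type Dat T -> forall rho, adequate rho -> data_like (interp rho T).
Proof.
  induction T; simpl; intros Hwf rho Hr t Ht.
  - destruct Hwf as [?| ->]; [discriminate|]. exact (proj2 (Hr Dat n) eq_refl t Ht).
  - exact (proj2 (evaluates_candidate Dat _) eq_refl t Ht).
  - exact (proj2 (evaluates_candidate Dat _) eq_refl t Ht).
  - destruct Hwf; discriminate.
  - destruct Hwf, Ht; [eapply IHT1|eapply IHT2]; eauto.
  - destruct Hwf, Ht. eapply IHT1; eauto.
  - eapply IHT; [assumption| |apply Ht, (bot_candidate _ k)].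
    apply adequate_extend; [apply bot_candidate|assumption].
  - destruct Ht as [A [HA Ht]]. eapply IHT; [assumption| |exact Ht].
    apply adequate_extend; assumption.
Qed.

Lemma interp_candidate (C : Type) k (T : type C) rho :
  wf_type k T -> adequate rho -> candidate k (interp rho T).
Proof.
  intros Hwf Hr. split; [apply interp_saturated; assumption|].
  intros ->. apply interp_data_like; assumption.
Qed.

Lemma interp_sn (C : Type) (T : type C) rho t :
  adequate rho -> interp rho T t -> sn t.
Proof. intros Hr. apply interp_saturated. assumption. Qed.

Lemma interp_tren (C : Type) (T : type C) :
  forall rho r, interp rho (tren r T) = interp (fun k n => rho k (r k n)) T.
Proof.
  assert (E : forall k (A : term C -> Prop) rho r,
    (fun k' n => extend k A rho k' (up_tren k r k' n)) =
    extend k A (fun k' n => rho k' (r k' n))).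
  { intros k A rho r. extensionality k'. extensionality n.
    unfold extend, up_tren. destruct k, k'; simpl; try reflexivity;
      destruct n; reflexivity. }
  induction T; intros rho r; simpl; rewrite ?IHT1, ?IHT2; auto;
    extensionality t; f_equal; extensionality A; rewrite IHT, E; reflexivity.
Qed.

Lemma interp_tshift (C : Type) (T : type C) k A rho :
  interp (extend k A rho) (tshift k T) = interp rho T.
Proof.
  unfold tshift. rewrite interp_tren. f_equal.
  extensionality k'. extensionality n. unfold extend. destruct k, k'; reflexivity.
Qed.

Lemma interp_tsubst (C : Type) (T : type C) :
  forall rho s, interp rho (tsubst s T) = interp (fun k n => interp rho (s k n)) T.
Proof.
  assert (E : forall k (A : term C -> Prop) rho s,
    (fun k' n => interp (extend k A rho) (up_t k s k' n)) =
    extend k A (fun k' n => interp rho (s k' n))).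
  { intros k A rho s. extensionality k'. extensionality n.
    unfold up_t. unfold extend at 2.
    destruct k, k'; simpl; try apply interp_tshift;
      destruct n; simpl; try apply interp_tshift; reflexivity. }
  induction T; intros rho r; simpl; rewrite ?IHT1, ?IHT2; auto;
    extensionality t; f_equal; extensionality A; rewrite IHT, E; reflexivity.
Qed.

Lemma interp_tsubst0 (C : Type) (T U : type C) k rho :
  interp rho (tsubst0 k U T) = interp (extend k (interp rho U) rho) T.
Proof.
  unfold tsubst0. rewrite interp_tsubst. f_equal.
  extensionality k'. extensionality n. unfold extend.
  destruct k, k'; try reflexivity; destruct n; reflexivity.
Qed.

Lemma interp_bigcap (C : Type) n (F : nat -> type C) rho t :
  interp rho (bigcap n F) t <-> forall i, i <= n -> interp rho (F i) t.
Proof.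
  induction n as [|n IH]; simpl.
  - split; [intros H i Hi; replace i with 0 by lia; assumption|].
    intros H. exact (H 0 (le_n 0)).
  - unfold bigcap in IH. rewrite IH. split.
    + intros [H1 H2] i Hi. destruct (PeanoNat.Nat.eq_dec i (S n)) as [->|];
        [assumption|]. apply H1. lia.
    + auto.
Qed.

Lemma interp_bigcup (C : Type) n (F : nat -> type C) rho t :
  interp rho (bigcup n F) t <-> exists i, i <= n /\ interp rho (F i) t.
Proof.
  induction n as [|n IH]; simpl.
  - split; [eauto|]. intros [i [Hi H]].
    replace i with 0 in H by lia. assumption.
  - unfold bigcup in IH. rewrite IH. split.
    + intros [[i [Hi H]]|H]; eauto.
    + intros [i [Hi H]]. destruct (PeanoNat.Nat.eq_dec i (S n)) as [->|]; [auto|].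
      left. exists i. split; [lia|assumption].
Qed.

Lemma interp_tarrs (C : Type) (Us : list (type C)) (T : type C) rho :
  forall t, interp rho (tarrs Us T) t <->
  forall us, Forall2 (fun u U => interp rho U u) us Us -> interp rho T (apps t us).
Proof.
  induction Us as [|U Us IH]; intros t; simpl.
  - split; [|intros H; exact (H [] (Forall2_nil _))].
    intros H us Hus. inversion Hus. assumption.
  - split.
    + intros H us Hus. inversion Hus as [|x ? xs ? Hx Hxs]; subst.
      exact (proj1 (IH _) (H _ Hx) _ Hxs).
    + intros H u Hu. apply IH. intros us Hus. apply (H (u :: us)). auto.
Qed.

Lemma interp_tapps_con (C : Type) c (Ts : list (type C)) rho t :
  interp rho (tapps (TCon c) Ts) t ->
  sn t /\ (whs t Dai \/ exists us, whs t (apps (Con c) us) /\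
    Forall2 (fun u U => interp rho U u) us Ts).
Proof.
  revert t. induction Ts as [|T Ts IH] using rev_ind; intros t.
  - intros [Ht [H|[v [H [_ ->]]]]]; split; auto. right. exists [].
    split; [assumption|constructor].
  - unfold tapps. rewrite fold_left_app. simpl. fold (tapps (TCon c) Ts).
    intros [Ht [H|[v [H [Hv [p [u [-> [Hp Hu]]]]]]]]]; split; auto. right.
    (* The function part of a constructor value is again one; hence it does not evaluate to [Dai]
       and is its own unique value. *)
    assert (Dp : data_value p).
    { destruct Hv as [d [vs E]]. destruct vs as [|v vs _] using rev_ind;
        [discriminate|]. rewrite apps_snoc in E. injection E as -> ->.
      exists d, vs. reflexivity. }
    destruct (IH _ Hp) as [_ [Hd|[us [Hw Hus]]]].
    + destruct (whs_Dai_data_value Hd (rt_refl1 _ _) Dp).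
    + exists (us ++ [u]). rewrite apps_snoc. split.
      * replace (apps (Con c) us) with p; [assumption|].
        apply value_unique with p; auto; [apply rt_refl1|].
        right. exists c, us. reflexivity.
      * apply Forall2_app; auto.
Qed.

(** * Soundness *)

Lemma interp_app_value (C : Type) (D T : type C) rho t :
  interp rho (TApp D T) t ->
  sn t /\ (whs t Dai \/ exists p u, whs t (App p u) /\ data_value (App p u) /\
    interp rho D p /\ interp rho T u).
Proof.
  intros [Ht [H|[v [H [Hv [p [u [-> [Hp Hu]]]]]]]]]; split; auto. right. eauto 7.
Qed.

Lemma interp_app_Dai (C : Type) (D T : type C) rho t :
  sn t -> whs t Dai -> interp rho (TApp D T) t.
Proof. intros Ht H. split; auto. Qed.

Lemma interp_app_intro (C : Type) (D T : type C) rho t p u :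
  sn t -> whs t (App p u) -> data_value (App p u) ->
  interp rho D p -> interp rho T u -> interp rho (TApp D T) t.
Proof. intros. split; [assumption|]. right. exists (App p u). eauto 7. Qed.

(** Distributing [TApp] over a family of types: all members of the family see the
    same weak head value. *)
Lemma interp_app_family (C I : Type) (D T : I -> type C) (rho : I -> valuation C)
    t (i0 : I) :
  (forall i, interp (rho i) (TApp (D i) (T i)) t) ->
  sn t /\ (whs t Dai \/ exists p u, whs t (App p u) /\ data_value (App p u) /\
    forall i, interp (rho i) (D i) p /\ interp (rho i) (T i) u).
Proof.
  intros H. destruct (interp_app_value (H i0)) as [Ht [Hd|[p [u [Hw [Hv _]]]]]];
    split; auto.
  right. exists p, u. split; [assumption|]. split; [assumption|]. intros i.
  destruct (interp_app_value (H i)) as [_ [Hd|[q [v [Hw' [Hv' Hi]]]]]].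
  - destruct (whs_Dai_data_value Hd Hw Hv).
  - assert (E : App p u = App q v) by (eapply value_unique; eauto).
    injection E as -> ->. assumption.
Qed.

Lemma sub_sound (C : Type) (T U : type C) :
  sub T U -> forall rho, adequate rho -> forall t, interp rho T t -> interp rho U t.
Proof.
  induction 1; intros rho Hr t Ht; auto.
  - intros u Hu. exact (IHsub2 _ Hr _ (Ht u (IHsub1 _ Hr _ Hu))).
  - destruct (interp_app_value Ht) as [Hs [Hd|[p [u [Hw [Hv [Hp Hu]]]]]]].
    + apply interp_app_Dai; assumption.
    + eapply interp_app_intro; eauto.
  - left. assumption.
  - right. assumption.
  - destruct Ht; auto.
  - apply Ht.
  - apply Ht.
  - split; auto.
  - intros A HA. apply IHsub; [apply adequate_extend; assumption|].
    rewrite interp_tshift. assumption.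
  - rewrite interp_tsubst0. apply Ht, interp_candidate; assumption.
  - rewrite interp_tsubst0 in Ht. eexists. split; [|eassumption].
    apply interp_candidate; assumption.
  - destruct Ht as [A [HA Ht]]. rewrite <- (interp_tshift T k A).
    apply IHsub; [apply adequate_extend|]; assumption.
  (* The value [v] of [t] is [Dai], which absorbs [u], or a constructor value, and then [App v u] is
     the value of [App t u]. *)
  - intros u Hu. pose proof (interp_sn _ _ Hr Ht) as Hs.
    pose proof (interp_sn _ _ Hr Hu) as Hsu.
    destruct (interp_data_like _ H Hr _ Ht) as [v [Hw [->|Hv]]].
    + apply interp_app_Dai.
      * eapply sn_whs_expand_app; [assumption|eassumption|].
        apply sn_Dai_app. assumption.
      * eapply rt_trans1; [apply whs_App; eassumption|].
        apply rt_step1, wh_root. constructor.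
    + pose proof (saturated_whs (interp_saturated D Hr) Hw Ht) as HDv.
      apply interp_app_intro with v u; auto.
      * eapply sn_whs_expand_app; [assumption|eassumption|].
        apply sn_data_value_App; auto. exact (interp_sn _ _ Hr HDv).
      * apply whs_App. assumption.
      * apply data_value_App. assumption.
  - destruct Ht as [H2 H3].
    destruct (interp_tapps_con _ _ _ _ H2) as [Hs H4].
    destruct (interp_tapps_con _ _ _ _ H3) as [_ H5].
    (* Otherwise [t] would have two values with different head constructors. *)
    assert (Hd : whs t Dai).
    { destruct H4 as [|[us [Hus _]]]; [assumption|].
      destruct H5 as [|[vs [Hvs _]]]; [assumption|].
      exfalso. apply H. eapply apps_Con_inj.
      eapply value_unique; [exact Hus|exact Hvs| |]; right; repeat eexists. }
    intros A [HA _]. simpl. apply saturated_whs_expand with Dai; auto. apply HA.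
  - assert (Ht' : forall i : {i | i <= n},
      interp rho (TApp (D (proj1_sig i)) (T (proj1_sig i))) t).
    { intros [i Hi]. rewrite interp_bigcap in Ht. auto. }
    destruct (interp_app_family (fun i => D (proj1_sig i)) (fun i => T (proj1_sig i))
      (fun _ => rho) (exist _ 0 (le_0_n n)) Ht') as [Hs [Hd|[p [u [Hw [Hv Hi]]]]]].
    + apply interp_app_Dai; assumption.
    + apply interp_app_intro with p u; auto; rewrite interp_bigcap; intros i Hin;
        apply (Hi (exist _ i Hin)).
  (* The family is indexed by all candidates, with [bot] as its inhabitant. *)
  - destruct (interp_app_family (fun _ : {A | candidate k A} => D) (fun _ => T)
      (fun A => extend k (proj1_sig A) rho) (t := t)
      (exist _ bot (bot_candidate _ k)) (fun A => Ht _ (proj2_sig A)))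
      as [Hs [Hd|[p [u [Hw [Hv Hi]]]]]].
    + apply interp_app_Dai; assumption.
    + apply interp_app_intro with p u; auto; intros A HA;
        apply (Hi (exist _ A HA)).
  - rewrite interp_bigcap in Ht. intros u Hu. rewrite interp_bigcap in *.
    intros i Hi. exact (Ht i Hi u (Hu i Hi)).
  - intros u Hu A HA. exact (Ht A HA u (Hu A HA)).
  - rewrite interp_bigcap in Ht. intros u Hu. rewrite interp_bigcup in *.
    destruct Hu as [i [Hi Hu]]. exists i. split; [assumption|]. exact (Ht i Hi u Hu).
  - intros u [A [HA Hu]]. exists A. split; [assumption|]. exact (Ht A HA u Hu).
  - destruct (interp_app_value Ht) as [Hs [Hd|[p [u [Hw [Hv [Hp Hu]]]]]]];
      rewrite interp_bigcup in *.
    (* A term evaluating to [Dai] lies in every member of the union, so any index would do. *)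
    + exists 0. split; [lia|]. apply interp_app_Dai; assumption.
    + destruct Hu as [i [Hi Hu]]. exists i. split; [assumption|].
      eapply interp_app_intro; eauto.
  - destruct (interp_app_value Ht) as [Hs [Hd|[p [u [Hw [Hv [Hp Hu]]]]]]];
      rewrite interp_bigcup in *.
    + exists 0. split; [lia|]. apply interp_app_Dai; assumption.
    + destruct Hp as [i [Hi Hp]]. exists i. split; [assumption|].
      eapply interp_app_intro; eauto.
  - destruct (interp_app_value Ht) as [Hs [Hd|[p [u [Hw [Hv [Hp Hu]]]]]]].
    + exists bot. split; [apply bot_candidate|]. apply interp_app_Dai; assumption.
    + destruct Hu as [A [HA Hu]]. exists A. split; [assumption|].
      eapply interp_app_intro; eauto. rewrite interp_tshift. assumption.
  - destruct (interp_app_value Ht) as [Hs [Hd|[p [u [Hw [Hv [Hp Hu]]]]]]].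
    + exists bot. split; [apply bot_candidate|]. apply interp_app_Dai; assumption.
    + destruct Hp as [A [HA Hp]]. exists A. split; [assumption|].
      eapply interp_app_intro; eauto. rewrite interp_tshift. assumption.
  (* Membership in [U] does not depend on the quantified candidate, so it can be decided classically
     once for all instances. *)
  - destruct (classic (interp rho U t)) as [HU|HU]; [right; assumption|left].
    intros A HA. destruct (Ht A HA) as [HT|HU']; [assumption|].
    rewrite interp_tshift in HU'. contradiction.
  - destruct Ht as [[A [HA HT]] HU]. exists A. split; [assumption|].
    split; [assumption|]. rewrite interp_tshift. assumption.
Qed.

(** A case binding is interpreted through the function it denotes, so that the
    rules shared by terms and bindings need only one treatment. *)
Definition code {C : Type} (M : expr C) : term C :=
  match M with
  | ETerm t => t
  | EBinding theta => Lam (Case (shift_binding theta) (Var 0))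
  end.

Lemma subst_code_binding (C : Type) (s : nat -> term C) (theta : binding C) :
  subst s (code (EBinding theta)) = code (EBinding (bmap (subst s) theta)).
Proof. simpl. do 2 f_equal. apply bmap_subst_shift. Qed.

Lemma wh_code_binding (C : Type) (theta : binding C) t :
  wh (App (code (EBinding theta)) t) (Case theta t).
Proof.
  change (Case theta t) with (Case theta (subst0 t (Var 0))).
  rewrite <- subst0_case_shift. apply wh_root. constructor.
Qed.

(** The coded function applied to [t] is a weak head expansion of [Case theta t]; normalising
    branches make its body, and thus the redex, normalise. *)
Lemma interp_arr_binding (C : Type) (theta : binding C) T U rho :
  adequate rho -> (forall c u, In (c, u) theta -> sn u) ->
  (forall t, interp rho T t -> interp rho U (Case theta t)) ->
  interp rho (TArr T U) (code (EBinding theta)).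
Proof.
  intros Hr Hsn H t Ht. pose proof (H t Ht) as Hc.
  destruct (interp_saturated U Hr) as [H1 [_ [_ H4]]].
  apply H4 with (Case theta t); [apply wh_code_binding| |assumption].
  apply sn_beta_expand.
  - apply sn_case_var. intros c u Hin.
    destruct (in_bmap shift theta c u Hin) as [v [Hv ->]]. apply sn_shift. eauto.
  - exact (interp_sn _ _ Hr Ht).
  - rewrite subst0_case_shift. apply H1. assumption.
Qed.

Lemma forall2_tshift (C : Type) k (A : term C -> Prop) rho vs (G : ctx C) :
  Forall2 (fun v T => interp rho T v) vs G ->
  Forall2 (fun v T => interp (extend k A rho) T v) vs (map (tshift k) G).
Proof.
  induction 1; simpl; constructor; [|assumption].
  rewrite interp_tshift. assumption.
Qed.

Lemma forall2_nth_error (A B : Type) (P : A -> B -> Prop) (d : A) l m :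
  Forall2 P l m -> forall x b, nth_error m x = Some b -> P (nth x l d) b.
Proof.
  induction 1; intros [|n] b E; simpl in *; try discriminate; auto.
  injection E as <-. assumption.
Qed.

(** The default [Dai] covers the indices beyond the context. *)
Definition assign {C : Type} (vs : list (term C)) (x : nat) : term C := nth x vs Dai.

Lemma scons_assign (C : Type) (u : term C) vs :
  scons u (assign vs) = assign (u :: vs).
Proof. extensionality x. destruct x; reflexivity. Qed.

(** Goes down to the join from [Case theta t'] and back up to [Case theta t], using both closure
    properties of [A]. *)
Lemma saturated_case_whs_expand (C : Type) (A : term C -> Prop) theta t t' :
  saturated A -> sn t -> whs t t' -> A (Case theta t') -> A (Case theta t).
Proof.
  intros HA Ht Hw Ht'. destruct (case_whs_join theta Hw) as [m [H1 H2]].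
  apply (saturated_whs_expand HA H1).
  - apply (sn_whs_expand_case Ht Hw). apply HA. assumption.
  - exact (saturated_whs HA H2 Ht').
Qed.

Lemma saturated_case_dai (C : Type) (A : term C -> Prop) theta :
  saturated A -> (forall c u, In (c, u) theta -> sn u) -> A (Case theta Dai).
Proof.
  intros HA H. apply (saturated_whs_expand HA (t' := Dai)).
  - apply rt_step1, wh_root. constructor.
  - apply sn_case_dai. assumption.
  - apply HA.
Qed.

(** If [t] evaluates to [Dai], so does the case. Otherwise the case moves past the arguments of [c0]
    and selects a branch, whose type accepts just these arguments. *)
Lemma binding_sound (C : Type) (theta : binding C) (Us : C -> list (type C))
    (T : C -> type C) c0 rho :
  adequate rho ->
  (forall c u, In (c, u) theta -> interp rho (tarrs (Us c) (T c)) u) ->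
  In c0 (dom theta) ->
  forall t, interp rho (tapps (TCon c0) (Us c0)) t -> interp rho (T c0) (Case theta t).
Proof.
  intros Hr H Hin t Ht.
  assert (Hsn : forall c u, In (c, u) theta -> sn u)
    by (intros c u Hu; exact (interp_sn _ _ Hr (H c u Hu))).
  pose proof (interp_saturated (T c0) Hr) as Hsat.
  destruct (interp_tapps_con _ _ _ _ Ht) as [Hs [Hw|[us [Hw Hus]]]];
    apply (saturated_case_whs_expand _ Hsat Hs Hw).
  - apply saturated_case_dai; assumption.
  - destruct (dom_look _ _ Hin) as [u Hu].
    assert (Hau : interp rho (T c0) (apps u us))
      by exact (proj1 (interp_tarrs _ _ _ _) (H c0 u (look_in Hu)) us Hus).
    apply (saturated_whs_expand Hsat (t' := apps u us)); [| |assumption].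
    + eapply rt_trans1; [apply whs_case_apps|].
      apply whs_apps, rt_step1, wh_root. constructor. assumption.
    + apply sn_case_apps_con, sn_apps_case_con with u; auto.
      * exact (sn_case_con Hsn Hu).
      * exact (interp_sn _ _ Hr Hau).
Qed.

Lemma typing_sound (C : Type) (G : ctx C) M T :
  typing G M T -> forall rho, adequate rho -> forall vs,
  Forall2 (fun v U => interp rho U v) vs G ->
  interp rho T (subst (assign vs) (code M)).
Proof.
  induction 1 as
    [G theta Us T c0 _ IH Hin|G theta T _ _ IH|G x T _ Hx|G T _ _|G c _
    |G t T U _ IH|G t u T U _ IHt _ IHu|G theta t Us T T' _ IHt _ IHb
    |G M k T _ IH|G M T U _ IHT _ IHU|G1 G2 M k T U _ IH
    |G1 G2 M T1 T2 U _ IH1 _ IH2|G M T U _ IH Hsub];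
    intros rho Hr vs Hvs.
  - rewrite subst_code_binding.
    assert (H : forall c u, In (c, u) (bmap (subst (assign vs)) theta) ->
      interp rho (tarrs (Us c) (T c)) u).
    { intros c u Hu. destruct (in_bmap _ _ _ _ Hu) as [v [Hv ->]].
      exact (IH c v Hv rho Hr vs Hvs). }
    apply interp_arr_binding; [assumption| |].
    + intros c u Hu. exact (interp_sn _ _ Hr (H c u Hu)).
    + intros t Ht. eapply binding_sound; eauto. rewrite dom_bmap. assumption.
  - rewrite subst_code_binding.
    assert (H : forall c u, In (c, u) (bmap (subst (assign vs)) theta) -> sn u).
    { intros c u Hu. destruct (in_bmap _ _ _ _ Hu) as [v [Hv ->]].
      exact (interp_sn _ _ Hr (IH c v Hv rho Hr vs Hvs)). }
    apply interp_arr_binding; [assumption|assumption|].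
    (* Instantiating the quantified data variable by [bot] forces [t] to evaluate to [Dai]. *)
    intros t Ht. pose proof (Ht _ (bot_candidate C Dat)) as Hb. simpl in Hb.
    pose proof (bot_whs Hb) as Hw. destruct Hb as [Hs _].
    intros A [HA _]. simpl. apply (saturated_case_whs_expand _ HA Hs Hw).
    apply saturated_case_dai; assumption.
  - exact (forall2_nth_error Dai Hvs _ Hx).
  - apply (interp_saturated T Hr).
  - split; [apply sn_Con|]. right. exists (Con c).
    split; [apply rt_refl1|]. split; [|reflexivity]. exists c, []. reflexivity.
  - intros u Hu.
    assert (H : interp rho U (subst (assign (u :: vs)) t))
      by (apply (IH rho Hr); constructor; assumption).
    rewrite <- scons_assign, <- subst0_subst_up in H.
    destruct (interp_saturated U Hr) as [H1 [_ [_ H4]]].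
    apply H4 with (subst0 u (subst (up (assign vs)) t)); [| |assumption].
    + apply wh_root. constructor.
    + apply sn_beta_expand; [|exact (interp_sn _ _ Hr Hu)|auto].
      (* The body normalises because its instance by [u] does. *)
      eapply sn_subst_inv, H1. exact H.
  - exact (IHt rho Hr vs Hvs _ (IHu rho Hr vs Hvs)).
  - apply interp_tarrs. intros us Hus.
    pose proof (proj1 (interp_tarrs _ _ _ _) (IHt rho Hr vs Hvs) us Hus) as H.
    pose proof (IHb rho Hr vs Hvs _ H) as Hc. rewrite subst_code_binding in Hc.
    pose proof (interp_saturated T' Hr) as Hsat.
    (* Typing puts the case around the fully applied term; closure under weak head reduction moves
       it inside the arguments [us]. *)
    apply (saturated_whs Hsat (whs_case_apps (bmap (subst (assign vs)) theta) us _)).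
    apply (saturated_whs Hsat (rt_step1 _ _ _ (wh_code_binding _ _))). exact Hc.
  - intros A HA. apply IH; [apply adequate_extend; assumption|].
    apply forall2_tshift. assumption.
  - split; auto.
  - apply Forall2_app_inv_r in Hvs. destruct Hvs as [vs1 [vs2 [H1 [H2 ->]]]].
    inversion H2 as [|v ? vs2' ? Hex H3]; subst. destruct Hex as [A [HA Hv]].
    rewrite <- (interp_tshift U k A).
    apply IH; [apply adequate_extend; assumption|].
    apply Forall2_app; [apply forall2_tshift; assumption|].
    constructor; [assumption|apply forall2_tshift; assumption].
  - apply Forall2_app_inv_r in Hvs. destruct Hvs as [vs1 [vs2 [H1 [H2 ->]]]].
    inversion H2 as [|v ? vs2' ? Hcup H3]; subst.
    destruct Hcup; [apply IH1|apply IH2]; auto; apply Forall2_app; auto.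
  - exact (sub_sound Hsub Hr _ (IH rho Hr vs Hvs)).
Qed.

(** [Dai] realises every type of the context, and normalisation of the instance reflects back to
    [t]. *)
Lemma typing_sn (C : Type) (G : ctx C) t T : typing G (ETerm t) T -> sn t.
Proof.
  intros H.
  assert (Hr : adequate (fun _ _ => @bot C)) by (intros k n; apply bot_candidate).
  apply (sn_subst_inv (assign (map (fun _ => Dai) G))).
  apply (interp_sn T _ Hr). apply (typing_sound H Hr).
  clear H. induction G; simpl; constructor; [|assumption].
  apply (interp_saturated _ Hr).
Qed.

(** * Perfect normalisation *)

Lemma wf_Lam (C : Type) (t : term C) : wf_term (Lam t) <-> wf_term t.
Proof.
  split; intros H theta u Hs.
  - eapply H. constructor. eassumption.
  - inversion Hs; subst. eapply H. eassumption.
Qed.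

Lemma wf_App (C : Type) (t u : term C) : wf_term (App t u) <-> wf_term t /\ wf_term u.
Proof.
  split.
  - intros H. split; intros theta v Hs; eapply H.
    + apply subterm_App_l. eassumption.
    + apply subterm_App_r. eassumption.
  - intros [H1 H2] theta v Hs. inversion Hs; subst; [eapply H1|eapply H2]; eassumption.
Qed.

Lemma wf_Case (C : Type) (theta : binding C) t :
  wf_term (Case theta t) <->
  NoDup (dom theta) /\ wf_term t /\ forall c u, In (c, u) theta -> wf_term u.
Proof.
  split.
  - intros H. split; [|split].
    + eapply H. constructor.
    + intros phi v Hs. eapply H. apply subterm_Case. eassumption.
    + intros c u Hin phi v Hs. eapply H. eapply subterm_binding; eassumption.
  - intros [H1 [H2 H3]] phi v Hs. inversion Hs; subst.
    + assumption.
    + eapply H2. eassumption.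
    + eapply H3; eassumption.
Qed.

Lemma wf_Var (C : Type) x : wf_term (@Var C x).
Proof. intros theta u Hs. inversion Hs. Qed.

Lemma wf_Dai (C : Type) : wf_term (@Dai C).
Proof. intros theta u Hs. inversion Hs. Qed.

Lemma wf_ren (C : Type) (t : term C) : forall r, wf_term t -> wf_term (ren r t).
Proof.
  induction t using term_nested_ind; intros r Hwf; simpl; auto using wf_Var.
  - rewrite wf_Lam in *. auto.
  - rewrite wf_App in *. destruct Hwf. auto.
  - fold (bmap (ren r) theta). rewrite wf_Case in *. rewrite dom_bmap.
    destruct Hwf as [H1 [H2 H3]]. split; [|split]; auto.
    intros c u Hin. destruct (in_bmap _ _ _ _ Hin) as [v [Hv ->]]. eauto.
Qed.

Lemma wf_subst (C : Type) (t : term C) :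
  forall s, (forall x, wf_term (s x)) -> wf_term t -> wf_term (subst s t).
Proof.
  induction t using term_nested_ind; intros s Hs Hwf; simpl; auto.
  - rewrite wf_Lam in *. apply IHt; [|assumption].
    intros [|x]; simpl; [apply wf_Var|apply wf_ren, Hs].
  - rewrite wf_App in *. destruct Hwf. auto.
  - fold (bmap (subst s) theta). rewrite wf_Case in *. rewrite dom_bmap.
    destruct Hwf as [H1 [H2 H3]]. split; [|split]; auto.
    intros c u Hin. destruct (in_bmap _ _ _ _ Hin) as [v [Hv ->]]. eauto.
Qed.

Lemma in_binding_replace (C : Type) (theta1 theta2 : binding C) c u u' d v :
  In (d, v) (theta1 ++ (c, u') :: theta2) ->
  v = u' \/ In (d, v) (theta1 ++ (c, u) :: theta2).
Proof.
  rewrite !in_app_iff. simpl. intros [H|[H|H]]; auto. injection H. auto.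
Qed.

Lemma dom_replace (C : Type) (theta1 theta2 : binding C) c u u' :
  dom (theta1 ++ (c, u') :: theta2) = dom (theta1 ++ (c, u) :: theta2).
Proof. unfold dom. rewrite !map_app. reflexivity. Qed.

Lemma wf_step (C : Type) (t t' : term C) : step t t' -> wf_term t -> wf_term t'.
Proof.
  induction 1; rewrite ?wf_Lam, ?wf_App, ?wf_Case, ?wf_App, ?wf_Lam; try tauto.
  - intros [H1 H2]. apply wf_subst; [|assumption].
    intros [|x]; [assumption|apply wf_Var].
  (* The eta-reduct is recovered from its shift by substituting an arbitrary well-formed term. *)
  - intros [H _]. rewrite <- (subst0_shift Dai t). apply wf_subst; [|assumption].
    intros [|x]; [apply wf_Dai|apply wf_Var].
  - intros [_ [_ H1]]. eauto.
  - change (@shift_binding C) with (bmap (@shift C)). rewrite dom_bmap.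
    intros [H1 [H2 H3]]. split; [|split]; auto.
    intros c u Hin. destruct (in_bmap _ _ _ _ Hin) as [v [Hv ->]]. apply wf_ren. eauto.
  - intros [H1 [H2 H3]]. rewrite (dom_replace theta1 theta2 c u u').
    split; [|split]; auto.
    intros d v Hin. destruct (in_binding_replace _ _ _ u _ _ _ Hin) as [->|Hv]; [|eauto].
    apply IHstep, (H3 c). apply in_elt.
Qed.

Lemma nodup_look (C : Type) c (u : term C) theta :
  NoDup (dom theta) -> In (c, u) theta -> look c u theta.
Proof.
  induction theta as [|[d v] theta IH]; simpl; [contradiction|].
  intros Hd. inversion Hd; subst. intros [[= -> ->]|Hin]; [constructor|].
  constructor; [|auto]. intros ->. eauto using in_dom.
Qed.

(** Distinctness of the constructors makes every matching branch the first match. *)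
Lemma step_red (C : Type) (t t' : term C) : step t t' -> wf_term t -> red t t'.
Proof.
  induction 1; rewrite ?wf_App, ?wf_Lam, ?wf_Case; intros Hwf;
    try (apply red_root; constructor; fail); eauto using red.
  - apply red_root. constructor. apply nodup_look; tauto.
  - apply red_App_l. tauto.
  - apply red_App_r. tauto.
  - apply red_Case. tauto.
  - apply red_binding, IHstep. destruct Hwf as [_ [_ H1]]. apply (H1 c), in_elt.
Qed.

(** The loop of [red_stuck] on the failing match is lifted through the surrounding context. *)
Lemma undefined_red (C : Type) (t : term C) : ~ defined t -> red t t.
Proof.
  intros H. apply NNPP in H. destruct H as [theta [c [Hs Hc]]].
  induction Hs; eauto using red.
  destruct (in_split _ _ H) as [theta1 [theta2 ->]]. apply red_binding. assumption.
Qed.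

Lemma sn_no_infinite_red (C : Type) (t : term C) :
  sn t -> forall f, f 0 = t -> ~ forall n, red (f n) (f (S n)).
Proof.
  induction 1 as [t _ IH]. intros f <- H.
  apply (IH (f 1) (H 0) (fun n => f (S n)) eq_refl). auto.
Qed.

Theorem theorem5p9 (C : Type) (t : term C) :
  wf_term t -> well_typed t -> perfectly_normalising t.
Proof.
  intros Hwf [G [T Ht]]. apply typing_sn in Ht. split.
  - intros [f [Hf H]].
    assert (Hwfn : forall n, wf_term (f n)).
    { induction n; [rewrite Hf; assumption|]. eapply wf_step; eauto. }
    apply (sn_no_infinite_red Ht f Hf). intros n. apply step_red; auto.
  - intros t' Hs. apply clos_rt_rt1n in Hs. induction Hs as [t|t t1 t' H _ IH].
    (* An undefined reduct would give a constant infinite sequence. *)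
    + apply NNPP. intros Hd. apply undefined_red in Hd.
      exact (sn_no_infinite_red Ht (fun _ => t) eq_refl (fun _ => Hd)).
    + apply IH; [exact (wf_step H Hwf)|]. exact (sn_red Ht (step_red H Hwf)).
Qed.
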